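(* Let $\mathrm{Re}\,p>0$. Then $$\int_0^\infty\frac{\eta^3(ix)\,dx}{(x+a)^p}=\int_0^\infty\frac{y^{p-1/2}\,\eta^3(iy)\,dy}{(1+ay)^p}=\frac{2}{\pi^p\,(p-1)!}\int_0^\infty\frac{x^{2p-1}e^{-ax^2/\pi}}{\cosh x}\,dx.$$
   Context: Here $\eta$ is the Dedekind eta function; for $x>0$, $\eta(ix)=q^{1/24}\prod_{n\ge1}(1-q^n)$ with $q=e^{-2\pi x}$, and $\eta^3(ix)$ means $(\eta(ix))^3$. $a$ is a parameter, and $(p-1)!$ means $\Gamma(p)$, where $\Gamma$ is the Gamma function. *)

(* Defs.v *)
From mathcomp Require Import all_boot all_order all_algebra.
From mathcomp Require Import complex.
From mathcomp Require Import all_classical all_reals all_analysis.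

Set Implicit Arguments.
Unset Strict Implicit.
Unset Printing Implicit Defensive.

Import Order.TTheory GRing.Theory Num.Theory.
Import numFieldNormedType.Exports.

Local Open Scope classical_set_scope.
Local Open Scope ring_scope.
Local Open Scope complex_scope.

Definition cexp (R : realType) (z : R[i]) : R[i] :=
  (expR (complex.Re z) * cos (complex.Im z)) +i*
  (expR (complex.Re z) * sin (complex.Im z)).

(* Principal argument, with values in ]-pi, pi]; only meaningful for z != 0. *)
Definition carg (R : realType) (z : R[i]) : R :=
  let t := acos (complex.Re z / Normc.normc z) in
  if 0 <= complex.Im z then t else - t.

Definition clog (R : realType) (z : R[i]) : R[i] :=
  ln (Normc.normc z) +i* carg z.

(* Principal branch of z ^ p; only meaningful for z != 0. *)
Definition cpow (R : realType) (z p : R[i]) : R[i] := cexp (p * clog z).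

Definition cosh (R : realType) (x : R) : R := (expR x + expR (- x)) / 2.

(* Lebesgue integrability and integral of a complex-valued function of a real
   variable, componentwise: for a measurable f, integrability of both
   components is the same as integrability of `|f|. *)
Definition cintegrable (R : realType) (D : set R) (f : R -> R[i]) : Prop :=
  (@lebesgue_measure R).-integrable D (fun x => (complex.Re (f x))%:E) /\
  (@lebesgue_measure R).-integrable D (fun x => (complex.Im (f x))%:E).

Definition cintegral (R : realType) (D : set R) (f : R -> R[i]) : R[i] :=
  Rintegral (@lebesgue_measure R) D (fun x => complex.Re (f x)) +i*
  Rintegral (@lebesgue_measure R) D (fun x => complex.Im (f x)).

(* Euler's integral: this is the Gamma function on the half-plane Re p > 0
   only, not its meromorphic continuation. *)
Definition cGamma (R : realType) (p : R[i]) : R[i] :=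
  cintegral `]0, +oo[ (fun t => cpow t%:C (p - 1) * (expR (- t))%:C).

(* The Dedekind eta function on the positive imaginary axis:
   eta_im x = eta(ix), with nome q = exp(-2 pi x); only meaningful for x > 0,
   where the infinite product converges. *)
Definition eta_im (R : realType) (x : R) : R :=
  let q := expR (- (2 * pi * x)) in
  q `^ (24%:R^-1) * limn (fun N => \prod_(1 <= n < N.+1) (1 - q ^+ n)).

(* Main.v *)
Require Import Defs.
From mathcomp Require Import all_boot all_order all_algebra.
From mathcomp Require Import complex.
From mathcomp Require Import all_classical all_reals all_analysis.
From mathcomp Require Import measurable_realfun zify ring lra.

Import Order.TTheory GRing.Theory Num.Theory.
Import numFieldNormedType.Exports.

(* Jacobi's identity writes eta(iy)^3 as the sum of
   (-1)^n (2n+1) exp(-pi (2n+1)^2 y / 4), and it is nonnegative by the product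
   formula.  Integrating termwise, for x > 0,
     int eta(iy)^3 exp(-x^2 y / pi) dy = sech x              (partial fractions),
     int y^(-1/2) eta(iy)^3 exp(-x^2 / (pi y)) dy = sech x   (geometric series),
   the second one because int y^(-1/2) exp(-A y - B / y) dy =
   sqrt(pi / A) exp(-2 sqrt(A B)).  Insert either formula for sech x into the
   right-hand side and exchange the integrals: the inner one is
     int x^(2p-1) exp(-w x^2 / pi) dx = pi^p Gamma(p) / (2 w^p)
   with w = a + y, respectively w = a + 1 / y, which gives the first, respectively
   the second integral.  The modular transformation of eta is not needed. *)

(** The termwise integrations are the delicate point: with the weight exp(-x^2 y / pi) the integrals
    of the absolute values of the terms add up to a divergent series of size sum 1 / (2n+1), so the
    alternating signs must be used before any domination. The exchange of the integrals rests on
    eta^3 >= 0: the absolute value of the double integrand then has the y-integral |k(x)| / cosh x,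
    which is explicit and integrable. The inner Gamma integral has a complex scale w. It is brought
    back to w = 1 without contour integration: w^p times the integral has derivative zero along a
    path in the right half-plane. Re a >= 0 keeps w = a + y and w = a + 1 / y in that half-plane,
    where the principal power is well behaved. Finally Gamma(p) has to be nonzero, since the
    identity is divided by it; this is proved directly from the integral by comparing large
    arguments. *)

Local Open Scope classical_set_scope.
Local Open Scope ring_scope.
Local Open Scope complex_scope.

(** * Pointwise derivatives *)

Section PointwiseDerivatives.
Context {R : realType}.
Implicit Types (f g : R -> R) (x df dg : R).

(* Not a class, so that the derivative is left as an evar for the [derive]
   tactic below instead of being guessed by instance resolution. *)
Definition hasder f x df : Prop := is_derive x 1 f df.

Lemma hasder_cst (c x : R) : hasder (fun _ : R => c) x 0.
Proof. exact: is_derive_cst. Qed.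

Lemma hasder_id x : hasder (fun y : R => y) x 1.
Proof. exact: is_derive_id. Qed.

Lemma hasder_add f g x df dg : hasder f x df -> hasder g x dg ->
  hasder (fun y => f y + g y) x (df + dg).
Proof. by move=> ? ?; exact: is_deriveD. Qed.

Lemma hasder_opp f x df : hasder f x df -> hasder (fun y => - f y) x (- df).
Proof. by move=> ?; exact: is_deriveN. Qed.

Lemma hasder_mul f g x df dg : hasder f x df -> hasder g x dg ->
  hasder (fun y => f y * g y) x (f x * dg + g x * df).
Proof. by move=> ? ?; exact: is_deriveM. Qed.

Lemma hasder_inv f x df : f x != 0 -> hasder f x df ->
  hasder (fun y => (f y)^-1) x (- (f x) ^- 2 * df).
Proof. by move=> ? ?; exact: is_deriveV. Qed.

Lemma hasder_exp f x n df : hasder f x df ->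
  hasder (fun y => f y ^+ n) x (n%:R * f x ^+ n.-1 * df).
Proof.
move=> fd; elim: n => [|n IHn]; first by rewrite !mul0r; exact: hasder_cst.
under eq_fun do rewrite exprS.
apply: is_derive_eq (hasder_mul _ _ _ _ _ fd IHn) _.
by case: n {IHn} => [|n]; rewrite ?expr0 -?[in RHS]natr1 ?exprS/=; ring.
Qed.

Lemma hasder_comp f g x df dg : hasder f (g x) df -> hasder g x dg ->
  hasder (fun y => f (g y)) x (df * dg).
Proof. by move=> ? ?; exact: (is_derive1_comp (f := f)). Qed.

Lemma hasder_expR f x df : hasder f x df ->
  hasder (fun y => expR (f y)) x (expR (f x) * df).
Proof. by apply: hasder_comp; exact: is_derive_expR. Qed.

Lemma hasder_cos f x df : hasder f x df ->
  hasder (fun y => cos (f y)) x (- sin (f x) * df).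
Proof. by apply: hasder_comp; exact: is_derive_cos. Qed.

Lemma hasder_sin f x df : hasder f x df ->
  hasder (fun y => sin (f y)) x (cos (f x) * df).
Proof. by apply: hasder_comp; exact: is_derive_sin. Qed.

Lemma hasder_ln f x df : 0 < f x -> hasder f x df ->
  hasder (fun y => ln (f y)) x ((f x)^-1 * df).
Proof. by move=> f0; apply: hasder_comp; exact: is_derive1_ln. Qed.

Lemma hasder_sqrt f x df : 0 < f x -> hasder f x df ->
  hasder (fun y => Num.sqrt (f y)) x ((2 * Num.sqrt (f x))^-1 * df).
Proof. by move=> f0; apply: hasder_comp; exact: is_derive1_sqrt. Qed.

Lemma hasder_atan f x df : hasder f x df ->
  hasder (fun y => atan (f y)) x ((1 + f x ^+ 2)^-1 * df).
Proof. by apply: hasder_comp; exact: is_derive1_atan. Qed.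

Lemma hasder_eq f x df df' : hasder f x df -> df = df' -> is_derive x 1 f df'.
Proof. by move=> fd <-. Qed.

Lemma hasder_continuous f x df : hasder f x df -> {for x, continuous f}.
Proof. by move=> [dfx _]; apply/differentiable_continuous/derivable1_diffP. Qed.

Lemma hasder_derive1 f x df : hasder f x df -> f^`()%classic x = df.
Proof. by rewrite derive1E => -[]. Qed.

End PointwiseDerivatives.

Ltac derive := repeat first
  [ apply: hasder_cst | apply: hasder_id | apply: hasder_opp | apply: hasder_expR
  | apply: hasder_cos | apply: hasder_sin | apply: hasder_ln | apply: hasder_sqrt
  | apply: hasder_atan | apply: hasder_inv | apply: hasder_exp
  | apply: hasder_add | apply: hasder_mul ].

Lemma cvg_to_eq {R : realType} {T : Type} {F : set_system T} (f : T -> R) (a b : R) :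
  f x @[x --> F] --> a -> a = b -> f x @[x --> F] --> b.
Proof. by move=> + <-. Qed.

(** * Jacobi's identity for the cube of the eta function *)

Section QBinomial.
Context {F : fieldType} (q : F).
Hypothesis qN1 : forall k, q ^+ k.+1 != 1.

Definition qfact n : F := \prod_(1 <= k < n.+1) (1 - q ^+ k).

(** The Gaussian binomial coefficient, for [j <= m] only: beyond that the truncated [m - j] gives a
    nonzero value instead of 0. *)
Definition qbin m j : F := qfact m / (qfact j * qfact (m - j)).

Lemma qfact0 : qfact 0 = 1.
Proof. by rewrite /qfact big_geq. Qed.

Lemma qfactS n : qfact n.+1 = qfact n * (1 - q ^+ n.+1).
Proof. by rewrite /qfact big_nat_recr. Qed.

Lemma qfact_neq0 n : qfact n != 0.
Proof.
elim: n => [|n IHn]; first by rewrite qfact0 oner_neq0.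
by rewrite qfactS mulf_neq0// subr_eq0 eq_sym.
Qed.

Lemma qbin0 m : qbin m 0 = 1.
Proof. by rewrite /qbin qfact0 mul1r subn0 divff// qfact_neq0. Qed.

Lemma qbinn m : qbin m m = 1.
Proof. by rewrite /qbin subnn qfact0 mulr1 divff// qfact_neq0. Qed.

Lemma qbin_sub m j : (j <= m)%N -> qbin m (m - j) = qbin m j.
Proof. by move=> jm; rewrite /qbin subKn// [qfact j * _]mulrC. Qed.

(** The q-Pascal rule. Over the common denominator it reads 1 - q^(m+1) = (1 - q^(m-j)) + q^(m-j) (1
    - q^(j+1)). *)
Lemma qbinS m j : (j < m)%N ->
  qbin m.+1 j.+1 = qbin m j.+1 + q ^+ (m - j) * qbin m j.
Proof.
move=> jm; rewrite /qbin subSS.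
have -> : (m - j = (m - j.+1).+1)%N by lia.
have E : (m.+1 = j.+1 + (m - j.+1).+1)%N by lia.
rewrite !qfactS {1}E exprD.
have := qfact_neq0 j; have := qfact_neq0 (m - j.+1).
have := qN1 j; have := qN1 (m - j.+1); rewrite -!(subr_eq0 _ 1) => h1 h2 h3 h4.
have h5 : 1 - q ^+ j.+1 != 0 by rewrite subr_eq0 eq_sym -subr_eq0.
have h6 : 1 - q ^+ (m - j.+1).+1 != 0 by rewrite subr_eq0 eq_sym -subr_eq0.
by field; rewrite h3 h4 h5 h6.
Qed.

Lemma q_binomial m :
  \prod_(0 <= k < m) (1 - q ^+ k *: 'X) =
  \sum_(0 <= j < m.+1) ((-1) ^+ j * q ^+ 'C(j, 2) * qbin m j) *: 'X^j :> {poly F}.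
Proof.
elim: m => [|m IHm].
  by rewrite big_geq// big_nat1 qbin0 mulr1 mulr1 scale1r.
rewrite big_nat_recr//= IHm mulrBr mulr1 mulr_suml.
rewrite [RHS]big_nat_recl// [in RHS]big_nat_recr//=.
rewrite [X in X - _]big_nat_recl//= -!addrA.
congr (_ + _); first by rewrite !qbin0.
rewrite [X in _ - X]big_nat_recr//= opprD addrA; congr (_ + _).
  rewrite -sumrB; apply: eq_big_nat => j /andP[_ jm].
  rewrite qbinS// -scalerAr -scalerAl -exprSr scalerA -scalerBl; congr (_ *: _).
  have -> : 'C(j.+1, 2) = ('C(j, 2) + j)%N by rewrite binS bin1 addnC.
  rewrite exprSr exprD.
  have -> : q ^+ m = q ^+ (m - j) * q ^+ j by rewrite -exprD subnK// ltnW.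
  by ring.
rewrite -scalerAr -scalerAl -exprSr scalerA -scaleNr; congr (_ *: _).
rewrite !qbinn binS bin1 exprD exprSr; ring.
Qed.

Lemma binS2_double k : ('C(k.+1, 2) * 2 = k.+1 * k)%N.
Proof. by rewrite mulnC -mul_bin_diag bin1. Qed.

Lemma bin2_double k : ('C(k, 2) * 2 + k = k * k)%N.
Proof. by case: k => // k; rewrite binS2_double; lia. Qed.

Hypothesis q0 : q != 0.

(* The derivative of the q-binomial theorem at the root [X = q ^ -n] of its
   product side. *)
Lemma finite_jacobi n :
  \sum_(0 <= i < n.+1)
     (-1) ^+ i * (2 * i + 1)%:R * q ^+ 'C(i.+1, 2) * qbin (2 * n + 1) (n - i) =
  qfact n ^+ 2.
Proof.
(* The factors of [P] have the roots q^-k with k <= 2n, and [x] is the middle one: at [x] the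
   derivative keeps only the product of the other 2n factors. *)
set m := (2 * n + 1)%N; pose x := q ^- n.
have qx : q ^+ n * x = 1 by rewrite mulfV// expf_neq0.
pose P := \prod_(0 <= k < m) (1 - q ^+ k *: 'X) : {poly F}.
pose a j := (-1) ^+ j * q ^+ 'C(j, 2) * qbin m j.
have dP1 : x * P^`().[x] = \sum_(0 <= j < m.+1) j%:R * a j * x ^+ j.
  rewrite /P q_binomial raddf_sum/= horner_sum mulr_sumr; apply: eq_bigr => j _.
  rewrite derivZ derivXn hornerZ hornerMn hornerXn -/(a j).
  case: j => [|j]; first by rewrite mulr0n !(mulr0, mul0r).
  by rewrite /= exprS -mulr_natl; ring.
pose Q1 := \prod_(0 <= k < n) (1 - q ^+ k *: 'X) : {poly F}.
pose Q2 := \prod_(n.+1 <= k < m) (1 - q ^+ k *: 'X) : {poly F}.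
have PE : P = Q1 * ((1 - q ^+ n *: 'X) * Q2).
  rewrite /P (@big_cat_nat _ _ _ n)//=; last by rewrite /m; lia.
  by rewrite (@big_ltn _ _ _ n)// /m; lia.
have dP2 : x * P^`().[x] = - (Q1.[x] * Q2.[x]).
  rewrite PE !derivM derivB derivZ derivX -[1]/(1%:P) derivC sub0r
    !(hornerM, hornerD, hornerN, hornerZ, hornerC, hornerX) qx.
  transitivity (- (q ^+ n * x) * (Q1.[x] * Q2.[x])); [ring | by rewrite qx mulN1r].
have Q2E : Q2.[x] = qfact n.
  rewrite /Q2 horner_prod -{1}[n.+1]addn1 addnC big_addn /m.
  have -> : (2 * n + 1 - n = n.+1)%N by lia.
  apply: eq_bigr => k _.
  by rewrite !(hornerD, hornerN, hornerZ, hornerC, hornerX) exprD -mulrA qx mulr1.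
(* The factors before the middle one become 1 - q^-k = - q^-k (1 - q^k) for 1 <= k <= n, and the
   powers q^-k multiply to q^-C(n+1,2). *)
have Q1E : q ^+ 'C(n.+1, 2) * Q1.[x] = (-1) ^+ n * qfact n.
  rewrite /Q1 horner_prod big_nat_rev/= add0n.
  rewrite (eq_big_nat _ _ (F2 := fun i => 1 - q ^- i.+1)); last first.
    move=> i /andP[_ ik].
    rewrite !(hornerD, hornerN, hornerZ, hornerC, hornerX) /x; congr (1 - _).
    have E1 : q ^+ n = q ^+ (n - i.+1) * q ^+ i.+1 by rewrite -exprD; congr (_ ^+ _); lia.
    by rewrite E1 invfM mulrA divff ?mul1r// expf_neq0.
  elim: (n) => [|k IHk]; first by rewrite big_geq// qfact0 bin_small// !mul1r.
  rewrite big_nat_recr//= qfactS binS bin1 exprD.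
  transitivity (q ^+ 'C(k.+1, 2) * \prod_(0 <= i < k) (1 - q ^- i.+1) *
     (q ^+ k.+1 * (1 - q ^- k.+1))); first by ring.
  rewrite IHk mulrBr divff ?expf_neq0// [(-1) ^+ k.+1]exprS mulr1; ring.
(* The exponent C(n+1,2) + C(j,2) - n j equals C(i+1,2) both for j = n - i and for j = n + 1 + i. *)
have tE i : (i <= n)%N -> q ^+ 'C(n.+1, 2) * (q ^+ 'C(n - i, 2) * x ^+ (n - i)) = q ^+ 'C(i.+1, 2).
  move=> ni; rewrite mulrA -exprD.
  have -> : ('C(n.+1, 2) + 'C(n - i, 2) = 'C(i.+1, 2) + n * (n - i))%N.
    have := binS2_double n; have := binS2_double i; have := bin2_double (n - i); nia.
  by rewrite exprD exprM -mulrA -exprMn qx expr1n mulr1.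
have tE' i : q ^+ 'C(n.+1, 2) * (q ^+ 'C(n.+1 + i, 2) * x ^+ (n.+1 + i)) = q ^+ 'C(i.+1, 2).
  rewrite mulrA -exprD.
  have -> : ('C(n.+1, 2) + 'C(n.+1 + i, 2) = 'C(i.+1, 2) + n * (n.+1 + i))%N.
    have := binS2_double n; have := binS2_double i; have := bin2_double (n.+1 + i); nia.
  by rewrite exprD exprM -mulrA -exprMn qx expr1n mulr1.
have {Q1E Q2E} : q ^+ 'C(n.+1, 2) * (x * P^`().[x]) = - ((-1) ^+ n * qfact n ^+ 2).
  by rewrite dP2 Q2E mulrN mulrA Q1E -mulrA -expr2.
(* Fold the sum around its middle: the indices n - i and n + 1 + i carry the same q-binomial and the
   same power of q with opposite signs, and (n + 1 + i) - (n - i) = 2i + 1 is the coefficient in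
   Jacobi's series. *)
rewrite dP1 (@big_cat_nat _ _ _ n.+1)//=; last by rewrite /m; lia.
rewrite -{3}[n.+1]add0n big_addn.
have -> : (m.+1 - n.+1 = n.+1)%N by rewrite /m; lia.
rewrite big_nat_rev/= add0n -big_split/= mulr_sumr => E.
apply: (@mulfI _ ((-1) ^+ n.+1)); first by rewrite signr_eq0.
rewrite [in RHS]exprS mulN1r mulNr -E mulr_sumr; apply: eq_big_nat => i /andP[_]; rewrite ltnS => ni.
rewrite subSS [(i + n.+1)%N]addnC [in RHS]mulrDr /a.
have -> : qbin m (n.+1 + i) = qbin m (n - i).
  by rewrite -qbin_sub; [congr qbin|]; rewrite /m; lia.
transitivity (((n - i)%:R * (-1) ^+ (n - i) * (q ^+ 'C(n.+1, 2) * (q ^+ 'C(n - i, 2) * x ^+ (n - i))) +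
  (n.+1 + i)%:R * (-1) ^+ (n.+1 + i) * (q ^+ 'C(n.+1, 2) * (q ^+ 'C(n.+1 + i, 2) * x ^+ (n.+1 + i)))) * qbin m (n - i)); last by ring.
have sE : (-1) ^+ (n - i) = - ((-1) ^+ (n.+1 + i)) :> F.
  by rewrite -signr_odd -[in RHS]signr_odd oddB// oddD/=; do 2 case: odd; rewrite /= ?expr0 ?expr1 ?opprK.
rewrite tE// tE' sE exprD natrB// natrD natrD natrM [in n.+1%:R]mulrSr.
by set s := (-1) ^+ n.+1; set t := (-1) ^+ i; ring.
Qed.
End QBinomial.

(** * Jacobi's identity as the limit of its finite form *)

Section JacobiLimit.
Context {R : realType}.
Implicit Types (b : nat -> R) (w : nat -> nat -> R).

(** Tannery's theorem (dominated convergence for series) when every [w ^~ i] has the same limit [l].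
    Once [l] is subtracted, finitely many head terms tend to 0 and the tail is controlled by that of
    [b]. *)
Lemma cvg_sum_tannery b w (l C : R) :
  cvgn (series (fun i => `|b i|)) -> (forall n i, (i < n)%N -> `|w n i| <= C) ->
  (forall i, w ^~ i @ \oo --> l) ->
  (fun n => \sum_(0 <= i < n) b i * w n i) @ \oo --> limn (series b) * l.
Proof.
move=> cb wC wl.
have cb' : cvgn (series b) by exact: normed_cvg.
have C0 : 0 <= C by exact: le_trans (wC 1%N 0%N isT).
have lC : `|l| <= C.
  rewrite -(cvg_lim (@Rhausdorff R) (cvg_norm (wl 0%N))).
  apply: limr_le; first by apply/cvg_ex; exists `|l|; exact: cvg_norm.
  by near=> n; apply: wC; near: n; exact: nbhs_infty_gt.
rewrite [X in X @ _ --> _](_ : _ = fun n =>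
    series b n * l + \sum_(0 <= i < n) b i * (w n i - l)); last first.
  apply/funext => n; rewrite /series/= mulr_suml -big_split/=.
  by apply: eq_bigr => i _; ring.
rewrite -[limn (series b) * l]addr0; apply: cvgD.
  exact: (@cvgMr_tmp R nat \oo _ (series b) _ l cb').
apply/cvgrPdist_le => e e0.
set S := series (fun i => `|b i|).
have ndS : nondecreasing_seq S by apply: nondecreasing_series => i _ _; exact: normr_ge0.
(* The head will cost one share of this size and the tail 2 C shares, because |w n i - l| <= 2 C;
   together exactly [e]. *)
have e'0 : 0 < e / (1 + 2 * C) by rewrite divr_gt0//; lra.
have [M _ HM] : \forall M \near \oo, `|limn S - S M| <= e / (1 + 2 * C).
  by move/cvgrPdist_le : cb; apply.
have {}HM n : (M <= n)%N -> \sum_(M <= i < n) `|b i| <= e / (1 + 2 * C).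
  move=> Mn; rewrite -sub_series_geq// -/S.
  apply: le_trans (HM M (leqnn _)).
  apply: le_trans (ler_norm _); rewrite lerB//.
  exact: nondecreasing_cvgn_le.
have fin m : (fun n => \sum_(0 <= i < m) b i * (w n i - l)) @ \oo --> (0 : R).
  elim: m => [|m IHm].
    by under eq_fun do rewrite big_geq//; exact: cvg_cst.
  under eq_fun do rewrite big_nat_recr//=.
  rewrite (_ : nbhs (0 : R) = nbhs (0 + b m * 0)); last by rewrite mulr0 addr0.
  apply: cvgD => //; apply: (@cvgMl_tmp R nat \oo _ (fun n => w n m - l) (b m) 0).
  by rewrite -(subrr l); apply: cvgB => //; exact: cvg_cst.
move/cvgrPdist_le : (fin M) => /(_ _ e'0) finM.
near=> n; rewrite sub0r normrN.
have Mn : (M <= n)%N by near: n; exact: nbhs_infty_ge.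
rewrite (@big_cat_nat _ _ _ M)//=.
apply: le_trans (ler_normD _ _) _.
have h1 : `|\sum_(0 <= i < M) b i * (w n i - l)| <= e / (1 + 2 * C).
  by rewrite -normrN -sub0r; near: n.
have h2 : `|\sum_(M <= i < n) b i * (w n i - l)| <= 2 * C * (e / (1 + 2 * C)).
  apply: le_trans (ler_norm_sum _ _ _) _.
  apply: le_trans (_ : \sum_(M <= i < n) 2 * C * `|b i| <= _).
    apply: ler_sum_nat => i /andP[_ ni]; rewrite normrM mulrC ler_wpM2r//.
    apply: le_trans (ler_normB _ _) _; have := wC n i ni; lra.
  by rewrite -mulr_sumr ler_wpM2l ?HM// mulr_ge0.
apply: le_trans (lerD h1 h2) _.
rewrite le_eqVlt; apply/orP; left; apply/eqP; field.
by apply: lt0r_neq0; lra.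
Unshelve. all: by end_near. Qed.

Variable q : R.
Hypotheses (q0 : 0 < q) (q1 : q < 1).

Lemma exprS_neq1 k : q ^+ k.+1 != 1.
Proof. by rewrite lt_eqF// exprn_ilt1// ltW. Qed.

(** Each factor satisfies 1 - q^k >= exp(-t) with t = q^k / (1 - q), since (1 - q^k) (1 + t) >= 1;
    the exponent is the geometric sum of these t. It yields a positive lower bound uniform in n,
    needed in the denominators of [qbin]. *)
Lemma qfact_ge n : expR (- (q * (1 - q ^+ n) / (1 - q) ^+ 2)) <= qfact q n.
Proof.
have q1' : 0 < 1 - q by rewrite subr_gt0.
elim: n => [|n IHn]; first by rewrite qfact0 subrr mulr0 mul0r oppr0 expR0.
have qn : q ^+ n.+1 <= q by rewrite exprS ler_piMr ?(ltW q0)// exprn_ile1// ltW.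
have -> : - (q * (1 - q ^+ n.+1) / (1 - q) ^+ 2) =
    - (q * (1 - q ^+ n) / (1 - q) ^+ 2) - q ^+ n.+1 / (1 - q).
  by rewrite exprS; field; rewrite lt0r_neq0.
rewrite qfactS expRD ler_pM ?expR_ge0// expRN -[leLHS]div1r.
rewrite ler_pdivrMr ?expR_gt0//; set t := q ^+ n.+1 / (1 - q).
have tE : q ^+ n.+1 = t * (1 - q) by rewrite divfK// lt0r_neq0.
apply: le_trans (_ : (1 - q ^+ n.+1) * (1 + t) <= _); last first.
  by rewrite ler_wpM2l ?expR_ge1Dx//; lra.
have : t * (1 - q) <= t * (1 - q ^+ n.+1).
  by rewrite ler_wpM2l//; [rewrite divr_ge0 ?exprn_ge0 ?(ltW q0) ?(ltW q1')|lra].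
rewrite -tE; lra.
Qed.

Definition qfact_lb : R := expR (- (q / (1 - q) ^+ 2)).

Lemma qfact_lb_le n : qfact_lb <= qfact q n.
Proof.
apply: le_trans (qfact_ge n); rewrite ler_expR lerN2 ler_wpM2r ?invr_ge0 ?exprn_even_ge0//.
by rewrite ler_piMr ?(ltW q0)// gerBl exprn_ge0// ltW.
Qed.

Lemma qfact_gt0 n : 0 < qfact q n.
Proof. by apply: lt_le_trans (qfact_lb_le n); exact: expR_gt0. Qed.

Lemma qfact_nincr : nonincreasing_seq (qfact q).
Proof.
apply/nonincreasing_seqP => n; rewrite qfactS ler_piMr ?(ltW (qfact_gt0 n))//.
by rewrite gerBl exprn_ge0// ltW.
Qed.

Lemma qfact_cvg : cvgn (qfact q).
Proof.
apply: nonincreasing_is_cvgn; first exact: qfact_nincr.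
by exists 0 => _ [n _ <-]; exact: ltW (qfact_gt0 n).
Qed.

Lemma lim_qfact_gt0 : 0 < limn (qfact q).
Proof.
apply: (@lt_le_trans _ _ qfact_lb); first exact: expR_gt0.
by apply: limr_ge; [exact: qfact_cvg|apply: nearW => n; exact: qfact_lb_le].
Qed.

Lemma qfact_le1 n : qfact q n <= 1.
Proof. by rewrite -(qfact0 q) qfact_nincr. Qed.

Lemma qbin_le n i : `|qbin q n i| <= qfact_lb ^- 2.
Proof.
rewrite ger0_norm; last by rewrite divr_ge0// ?mulr_ge0// ltW// qfact_gt0.
rewrite -[leRHS]mul1r ler_pM ?invr_ge0 ?mulr_ge0 ?(ltW (qfact_gt0 _))// ?qfact_le1//.
rewrite lef_pV2 ?posrE ?mulr_gt0 ?exprn_gt0 ?qfact_gt0 ?expR_gt0//.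
by rewrite expr2 ler_pM ?expR_ge0// qfact_lb_le.
Qed.

Definition jacobi_coef i : R := (-1) ^+ i * (2 * i + 1)%:R * q ^+ 'C(i.+1, 2).

(** i r^i is at most r + ... + r^i, which is what the induction below proves after multiplication by
    1 - r. *)
Lemma mul_exprn_bound (r : R) i : 0 < r < 1 -> i%:R * r ^+ i <= r / (1 - r).
Proof.
move=> /andP[r0 r1]; have r1' : 0 < 1 - r by rewrite subr_gt0.
rewrite ler_pdivlMr//.
suff : i%:R * r ^+ i * (1 - r) <= r - r ^+ i.+1.
  by move/le_trans; apply; rewrite gerBl exprn_ge0// ltW.
elim: i => [|i IHi]; first by rewrite !mul0r expr1 subrr.
have h1 : r ^+ i <= 1 by rewrite exprn_ile1// ltW.
have h2 := ler_wpM2l (ltW r0) IHi.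
have h3 : r * (1 - r) * r ^+ i <= r * (1 - r) by rewrite ler_piMr// mulr_ge0// ltW.
by move: h2 h3; rewrite -natr1 !exprS; set u := r ^+ i; set k := i%:R; lra.
Qed.

Lemma jacobi_coef_summable : cvgn (series (fun i => `|jacobi_coef i|)).
Proof.
(* q^C(i+1,2) <= q^i = r^i r^i: one factor r^i absorbs the linear coefficient 2i + 1, the other
   leaves a geometric series. *)
pose r := Num.sqrt q.
have r0 : 0 < r by rewrite sqrtr_gt0.
have r1 : r < 1 by rewrite -sqrtr1 ltr_sqrt.
apply: (@series_le_cvg _ _ (geometric (2 * (r / (1 - r)) + 1) r)).
- by move=> i; exact: normr_ge0.
- move=> i; rewrite /geometric/= mulr_ge0 ?exprn_ge0 ?(ltW r0)//.
  by rewrite addr_ge0// mulr_ge0// divr_ge0 ?subr_ge0// ltW.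
- move=> i; rewrite /geometric/= !normrM normr_sign mul1r normr_nat.
  rewrite (ger0_norm (exprn_ge0 _ (ltW q0))).
  apply: (@le_trans _ _ ((2 * i + 1)%:R * q ^+ i)).
    rewrite ler_wpM2l// ler_wiXn2l ?(ltW q0) ?(ltW q1)//.
    by rewrite binS bin1 leq_addl.
  rewrite (_ : q ^+ i = r ^+ i * r ^+ i); last first.
    by rewrite -exprMn -expr2 sqr_sqrtr// ltW.
  rewrite [leLHS]mulrA ler_wpM2r ?exprn_ge0 ?(ltW r0)//.
  rewrite natrD natrM mulrDl mul1r lerD//.
    by rewrite -mulrA ler_wpM2l// mul_exprn_bound// r0.
  by rewrite exprn_ile1// ltW.
- by apply: is_cvg_geometric_series; rewrite gtr0_norm.
Qed.

(** Let n grow in [finite_jacobi]: the q-binomials tend to 1 / E with E the infinite product, and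
    the right-hand side to E^2, so the series divided by E is E^2. *)
Theorem jacobi_identity : series jacobi_coef @ \oo --> limn (qfact q) ^+ 3.
Proof.
set E := limn (qfact q).
have E0 : E != 0 by rewrite lt0r_neq0// lim_qfact_gt0.
have cj : cvgn (series jacobi_coef) by exact/normed_cvg/jacobi_coef_summable.
suff -> : E ^+ 3 = limn (series jacobi_coef) by exact: cj.
have cS (k : nat) : qfact q (n + k)%N @[n --> \oo] --> E.
  by have := qfact_cvg; rewrite -(cvg_shiftn k).
(* [n.-1] because [finite_jacobi n] has n + 1 terms while [cvg_sum_tannery] sums over i < n. The
   limit arises as E / (E * E). *)
have wl i : (fun n => qbin q (2 * n.-1 + 1) (n.-1 - i)) @ \oo --> E^-1.
  rewrite -(cvg_shiftn i.+1)/=.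
  rewrite [X in X @ _ --> _](_ : _ = fun n =>
    qfact q (2 * (n + i) + 1) / (qfact q n * qfact q (n + (2 * i + 1)))); last first.
    apply/funext => n; rewrite (_ : (n + i.+1).-1 = n + i)%N; last by lia.
    by rewrite /qbin addnK; congr (_ / (_ * qfact q _)); lia.
  rewrite (_ : E^-1 = E / (E * E)); last by field.
  apply: cvgM.
    apply: (cvg_comp (fun n => (2 * (n + i) + 1)%N) (qfact q)); last exact: qfact_cvg.
    by apply/cvgnyPge => A; near=> n; near: n; exists A => // n /= An; lia.
  apply: cvgV; first by rewrite mulf_neq0.
  by apply: cvgM; [exact: qfact_cvg|exact: cS].
have T := cvg_sum_tannery _ (fun n i => qbin q (2 * n.-1 + 1) (n.-1 - i)) _ _
  jacobi_coef_summable (fun n i _ => qbin_le _ _) wl.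
have : (fun n => qfact q n.-1 ^+ 2) @ \oo --> limn (series jacobi_coef) / E.
  rewrite -(cvg_shiftn 1)/=; move: T; rewrite -(cvg_shiftn 1)/=.
  under eq_fun do rewrite addn1/=.
  under [X in _ -> X @ _ --> _]eq_fun do rewrite addn1/=.
  move=> T; apply: cvg_trans T; apply: near_eq_cvg; apply: nearW => n /=.
  by rewrite (finite_jacobi _ exprS_neq1) ?lt0r_neq0.
have : (fun n => qfact q n.-1 ^+ 2) @ \oo --> E ^+ 2.
  rewrite -(cvg_shiftn 1)/=; under eq_fun do rewrite addn1/=.
  by rewrite expr2; apply: cvgM; exact: qfact_cvg.
move=> /(cvg_lim (@Rhausdorff R)) h1 /(cvg_lim (@Rhausdorff R)) h2.
by rewrite exprSr -h1 h2 divfK.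
Unshelve. all: by end_near. Qed.

End JacobiLimit.

(** * Improper integrals *)

Section ImproperIntegrals.
Context {R : realType}.
Notation mu := (@lebesgue_measure R).
Implicit Types (f F : R -> R) (D B : set R).

(** Dominated convergence for the restrictions of [f] to [A n], with majorant |f|. It serves both to
    truncate improper integrals and to find the limits of primitives at the ends. *)
Lemma cvg_Rintegral_sets D f (A : nat -> set R) B : measurable D ->
  (forall n, measurable (A n)) -> measurable B ->
  mu.-integrable D (EFin \o f) ->
  (forall x, D x -> \forall n \near \oo, A n x <-> B x) ->
  \int[mu]_(x in D `&` A n) f x @[n --> \oo] --> \int[mu]_(x in D `&` B) f x.
Proof.
move=> mD mA mB intf AB.
have mf : measurable_fun D f by apply/measurable_EFinP; exact: measurable_int intf.
have mr C : measurable C -> measurable_fun D (EFin \o (f \_ C)).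
  move=> mC; apply/measurable_EFinP/(measurable_restrict f mC mD).
  by apply: measurable_funS mf => // x [].
have cvgf : {ae mu, forall x, D x -> (EFin \o (f \_ (A n))) x @[n --> \oo] --> (EFin \o (f \_ B)) x}.
  apply: aeW => x Dx; apply: cvg_near_cst.
  have := AB x Dx; apply: filterS => n ABn.
  by rewrite /= /patch; congr (_%:E); case: ifPn; case: ifPn => //;
    rewrite ?notin_setE ?in_setE; tauto.
have bf : {ae mu, forall x, forall n, D x -> (`|(EFin \o (f \_ (A n))) x| <= (`|f x|)%:E)%E}.
  by apply: aeW => x n Dx; rewrite /= lee_fin /patch; case: ifPn => // _; rewrite normr0.
have [ifB _ h] := @dominated_convergence _ _ R mu D mD (fun n => EFin \o (f \_ (A n)))
  (EFin \o (f \_ B)) (fun x => (`|f x|)%:E) (fun n => mr _ (mA n)) (mr _ mB) cvgf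
  (integrable_norm intf) bf.
rewrite Rintegral_mkcondr; under eq_fun do rewrite Rintegral_mkcondr.
apply: fine_cvg; rewrite /Rintegral fineK; first exact: h.
exact: integrable_fin_num.
Qed.

(** Truncation to [1 / (n+2), n+2]; the shift by 2 keeps the interval nondegenerate at n = 0, as the
    fundamental theorem of calculus requires. *)
Let a_ (n : nat) : R := n.+2%:R^-1.
Let b_ (n : nat) : R := n.+2%:R.

Let a_gt0 n : 0 < a_ n. Proof. by rewrite invr_gt0. Qed.

Let ab_ n : a_ n < b_ n.
Proof.
by rewrite (@lt_trans _ _ 1)// ?ltr1n// invf_lt1 ?ltr1n ?ltr0n.
Qed.

Let a_cvg : a_ @ \oo --> (0 : R).
Proof.
by have := @cvg_harmonic R; rewrite -(cvg_shiftn 1); under eq_fun do rewrite /= addn1.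
Qed.

Let b_cvg : b_ @ \oo --> +oo.
Proof.
have := @cvgr_idn R; rewrite -(cvg_shiftn 2)/=.
by under eq_fun do rewrite addn2.
Qed.

Let near_ab x : 0 < x -> \forall n \near \oo, a_ n <= x <= b_ n.
Proof.
move=> x0; near=> n; apply/andP; split.
  apply/ltW; near: n; move/cvgr_lt : a_cvg; exact.
by near: n; move/cvgryPge : b_cvg; exact.
Unshelve. all: by end_near. Qed.

Let ab_sub n : `[a_ n, b_ n] `<=` `]0, +oo[.
Proof.
move=> x /=; rewrite !in_itv/= andbT => /andP[+ _].
exact: lt_le_trans.
Qed.

Let measurable_pos f : (forall x : R, 0 < x -> {for x, continuous f}) ->
  measurable_fun (`]0, +oo[ : set R) f.
Proof.
move=> cf; apply: open_continuous_measurable_fun; first exact: interval_open.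
by move=> x; rewrite inE/= in_itv/= andbT => /cf.
Qed.

Let FTC_ab f F n : (forall x : R, 0 < x -> {for x, continuous f}) ->
  (forall x : R, 0 < x -> is_derive x 1 F (f x)) ->
  (\int[mu]_(x in `[a_ n, b_ n]) (f x)%:E = (F (b_ n) - F (a_ n))%:E)%E.
Proof.
move=> cf dF; rewrite EFinB; apply: continuous_FTC2 => //.
- apply: continuous_in_subspaceT => x; rewrite inE => /ab_sub/=.
  by rewrite in_itv/= andbT => /cf.
- have cF (x : R) : 0 < x -> {for x, continuous F}.
    by move=> /dF [dFx _]; apply/differentiable_continuous/derivable1_diffP.
  split.
  + move=> x; rewrite in_itv/= => /andP[ax _].
    by apply: ex_derive; apply: dF; exact: lt_trans ax.
  + by apply: cvg_at_right_filter; apply: cF.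
  + by apply: cvg_at_left_filter; apply: cF; exact: lt_trans (ab_ n).
- move=> x; rewrite in_itv/= => /andP[ax _].
  by rewrite derive1E; have [_] := dF _ (lt_trans (a_gt0 n) ax).
Qed.

Lemma FTC_0y f F (l0 l1 : R) : (forall x : R, 0 < x -> {for x, continuous f}) ->
  (forall x : R, 0 < x -> is_derive x 1 F (f x)) ->
  F x @[x --> 0^'+] --> l0 -> F x @[x --> +oo] --> l1 ->
  mu.-integrable `]0, +oo[ (EFin \o f) ->
  \int[mu]_(x in `]0, +oo[) f x = l1 - l0.
Proof.
move=> cf dF F0 F1 intf.
have := @cvg_Rintegral_sets _ f (fun n => `[a_ n, b_ n]%classic) setT
  (measurable_itv _) (fun n => measurable_itv _) measurableT intf.
rewrite setIT => h; rewrite -(cvg_lim (@Rhausdorff R) (h _)); last first.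
  by move=> x /=; rewrite in_itv/= andbT => /near_ab; apply: filterS => n; rewrite in_itv/=.
apply: cvg_lim; first exact: Rhausdorff.
under eq_fun do rewrite (setIidr (@ab_sub _)) /Rintegral FTC_ab//=.
apply: cvgB.
  by move/cvg_pinftyP : F1; apply.
by move/cvg_at_rightP : F0; apply.
Qed.

(** For f >= 0 monotone convergence along the truncations replaces the dominated one of [FTC_0y], so
    that integrability becomes a consequence of the finite limits of the primitive. *)
Lemma FTC_0y_ge0 f F (l0 l1 : R) : (forall x : R, 0 < x -> 0 <= f x) ->
  (forall x : R, 0 < x -> {for x, continuous f}) ->
  (forall x : R, 0 < x -> is_derive x 1 F (f x)) ->
  F x @[x --> 0^'+] --> l0 -> F x @[x --> +oo] --> l1 ->
  (\int[mu]_(x in `]0%R, +oo[) (f x)%:E = (l1 - l0)%:E)%E.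
Proof.
move=> f0 cf dF F0 F1.
have U : `]0, +oo[%classic = \bigcup_n `[a_ n, b_ n]%classic.
  apply/seteqP; split => x /=.
    rewrite in_itv/= andbT => /near_ab[n _ /(_ n (leqnn _))] h.
    by exists n => //=; rewrite in_itv.
  by case=> n _; exact: ab_sub.
have nd : nondecreasing_seq (fun n => `[a_ n, b_ n]%classic).
  apply/nondecreasing_seqP => n; apply/subsetPset => x /=.
  rewrite !in_itv/= => /andP[h1 h2]; apply/andP; split.
    by apply: le_trans h1; rewrite lef_pV2 ?posrE// ler_nat.
  by apply: (le_trans h2); rewrite ler_nat.
have mf n : measurable_fun (`[a_ n, b_ n] : set R) (EFin \o f).
  apply/measurable_EFinP; apply: measurable_funS (measurable_pos _ cf) => //.
have h := @ge0_nondecreasing_set_cvg_integral _ _ _ _ _ mu nd (fun n => measurable_itv _) mf.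
rewrite U -(cvg_lim (@ereal_hausdorff R) (h _)); last first.
  by move=> n x /ab_sub /=; rewrite in_itv/= andbT lee_fin; exact: f0.
apply: cvg_lim; first exact: ereal_hausdorff.
under eq_fun do rewrite /= FTC_ab//.
apply: cvg_EFin; first exact: nearW.
apply: (@cvgB _ R^o).
  by move/cvg_pinftyP : F1; apply.
by move/cvg_at_rightP : F0; apply.
Qed.

Lemma FTC_0y_ge0_integrable f F (l0 l1 : R) : (forall x : R, 0 < x -> 0 <= f x) ->
  (forall x : R, 0 < x -> {for x, continuous f}) ->
  (forall x : R, 0 < x -> is_derive x 1 F (f x)) ->
  F x @[x --> 0^'+] --> l0 -> F x @[x --> +oo] --> l1 ->
  mu.-integrable `]0, +oo[ (EFin \o f).
Proof.
move=> f0 cf dF F0 F1; apply/integrableP; split.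
  by apply/measurable_EFinP; exact: measurable_pos.
suff -> : (\int[mu]_(x in `]0%R, +oo[) `|(EFin \o f) x| = (l1 - l0)%:E)%E by rewrite ltry.
rewrite -(FTC_0y_ge0 _ _ _ _ f0 cf dF F0 F1); apply: eq_integral => x.
by rewrite inE/= in_itv/= andbT => x0; rewrite ger0_norm// f0.
Qed.

(* The fundamental theorem applied to the primitive of [f] composed with [phi];
   applied to [`|f|] it also gives integrability. *)
Lemma substitution_0y f (phi dphi : R -> R) : (forall x : R, 0 < x -> {for x, continuous f}) ->
  mu.-integrable `]0, +oo[ (EFin \o f) ->
  (forall x : R, 0 < x -> 0 < phi x) -> (forall x : R, 0 < x -> 0 <= dphi x) ->
  (forall x : R, 0 < x -> is_derive x 1 phi (dphi x)) ->
  (forall x : R, 0 < x -> {for x, continuous dphi}) ->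
  phi x @[x --> (0:R)^'+] --> (0:R) -> phi x @[x --> +oo] --> +oo ->
  mu.-integrable `]0, +oo[ (EFin \o (fun x => f (phi x) * dphi x)) /\
  \int[mu]_(x in `]0, +oo[) (f (phi x) * dphi x) = \int[mu]_(x in `]0, +oo[) f x.
Proof.
move=> cf intf phi0 dphi0 dphiE cdphi phi00 phiy.
have cphi (x : R) : 0 < x -> {for x, continuous phi}.
  by move=> /dphiE [dx _]; apply/differentiable_continuous/derivable1_diffP.
have primitive (g : R -> R) : (forall x : R, 0 < x -> {for x, continuous g}) ->
    mu.-integrable `]0, +oo[ (EFin \o g) ->
  let G u := \int[mu]_(x in `]0, u]) g x in
  [/\ forall x : R, 0 < x -> is_derive x 1 (G \o phi) (g (phi x) * dphi x),
    (G \o phi) x @[x --> (0:R)^'+] --> (0:R),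
    (G \o phi) x @[x --> +oo] --> \int[mu]_(x in `]0, +oo[) g x &
    forall x : R, 0 < x -> {for x, continuous (fun x => g (phi x) * dphi x)}].
  move=> cg intg G.
  have dG (u : R) : 0 < u -> is_derive u 1 G (g u).
    move=> u0; have uu : u < u + 1 by rewrite ltrDl.
    have h1 : mu.-integrable `]0, u + 1] (EFin \o g).
      by apply: integrableS intg => // x /=; rewrite !in_itv/= => /andP[->].
    have h2 : (BRight (0 : R) < BRight u)%O by [].
    have [dGu <-] := continuous_FTC1 uu h1 h2 (cg u u0).
    by rewrite derive1E; exact: DeriveDef.
  split.
  - move=> x x0.
    apply: (@is_derive1_comp R G phi x (g (phi x)) (dphi x)).
    + by apply: dG; exact: phi0.
    + exact: dphiE.
  - apply/cvg_at_rightP => u [u0 u_cvg].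
    have := @cvg_Rintegral_sets _ g (fun n => `]0, phi (u n)]%classic) set0
      (measurable_itv _) (fun n => measurable_itv _) measurable0 intg.
    rewrite setI0 Rintegral_set0 => h.
    rewrite [X in X @ _ --> _](_ : _ = fun n => \int[mu]_(x in `]0, +oo[ `&` `]0, phi (u n)]) g x).
      apply: h => x /=; rewrite in_itv/= andbT => x0.
      have : phi (u n) @[n --> \oo] --> 0 by move/cvg_at_rightP : phi00; apply.
      move=> /cvgr_lt /(_ x x0); apply: filterS => n phix; split => //.
      by rewrite in_itv/= => /andP[_]; rewrite leNgt phix.
    apply/funext => n /=; rewrite /G setIidr// => x /=.
    by rewrite !in_itv/= andbT => /andP[].
  - apply/cvg_pinftyP => u u_cvg.
    have := @cvg_Rintegral_sets _ g (fun n => `]0, phi (u n)]%classic) setT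
      (measurable_itv _) (fun n => measurable_itv _) measurableT intg.
    rewrite setIT => h.
    rewrite [X in X @ _ --> _](_ : _ = fun n => \int[mu]_(x in `]0, +oo[ `&` `]0, phi (u n)]) g x).
      apply: h => x /=; rewrite in_itv/= andbT => x0.
      have : phi (u n) @[n --> \oo] --> +oo by exact: cvg_comp u_cvg phiy.
      move=> /cvgryPge /(_ x); apply: filterS => n phix; split => // _.
      by rewrite in_itv/= x0.
    apply/funext => n /=; rewrite /G setIidr// => x /=.
    by rewrite !in_itv/= andbT => /andP[].
  - move=> x x0; apply: (@continuousM _ _ (g \o phi) dphi); last exact: cdphi.
    by apply: continuous_comp; [exact: cphi|apply: cg; exact: phi0].
have [d1 l10 l1y c1] := primitive f cf intf.
have cn (x : R) : 0 < x -> {for x, continuous (fun x => `|f x|)}.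
  by move=> x0; apply: (@continuous_comp _ _ _ f); [exact: cf|exact: norm_continuous].
have [d2 l20 l2y c2] := primitive (fun x => `|f x|) cn (integrable_norm intf).
have int1 : mu.-integrable `]0, +oo[ (EFin \o (fun x => f (phi x) * dphi x)).
  have int2 := FTC_0y_ge0_integrable _ _ _ _
    (fun x x0 => mulr_ge0 (normr_ge0 (f (phi x))) (dphi0 x x0)) c2 d2 l20 l2y.
  apply: le_integrable int2 => //; first by apply/measurable_EFinP; exact: measurable_pos.
  move=> x /=; rewrite in_itv/= andbT => x0.
  by rewrite lee_fin !normrM normr_id.
by split => //; rewrite (FTC_0y _ _ _ _ c1 d1 l10 l1y int1) subr0.
Qed.

End ImproperIntegrals.

(** * Exponential, Gaussian and Cauchy-Schlomilch integrals *)

Section ExplicitIntegrals.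
Context {R : realType}.
Notation mu := (@lebesgue_measure R).

Lemma integral_expN (c : R) : 0 < c ->
  (\int[mu]_(x in `]0%R, +oo[) (expR (- (c * x)))%:E = (c^-1)%:E)%E.
Proof.
move=> c0; have c1 : c != 0 by rewrite lt0r_neq0.
pose F x := - (c^-1 * expR (- (c * x))).
have dF (x : R) : is_derive x 1 F (expR (- (c * x))).
  by apply: hasder_eq; [derive|rewrite /=; field].
have df (x : R) : is_derive x 1 (fun x => expR (- (c * x))) (- (c * expR (- (c * x)))).
  by apply: hasder_eq; [derive|rewrite /=; ring].
have F0 : F x @[x --> 0^'+] --> - c^-1.
  have -> : - c^-1 = F 0 by rewrite /F mulr0 oppr0 expR0 mulr1.
  by apply: cvg_at_right_filter; exact: hasder_continuous (dF 0).
have Fy : F x @[x --> +oo] --> (0 : R).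
  rewrite -oppr0; apply: cvgN; rewrite -(mulr0 c^-1); apply: cvgMl_tmp.
  apply: (@cvg_comp _ _ _ (fun x => c * x) (fun x => expR (- x))); last exact: cvgr_expR.
  exact: gt0_cvgMry.
rewrite -[c^-1]add0r -[c^-1 in RHS]opprK.
apply: (FTC_0y_ge0 (fun x => expR (- (c * x))) F) => //.
by move=> x _; exact: hasder_continuous (df x).
Qed.

Definition gauss_primitive (u : R) := \int[mu]_(t in `]-oo, u]) gauss_fun t.

Lemma is_derive_gauss_primitive (u : R) : is_derive u 1 gauss_primitive (gauss_fun u).
Proof.
have uu : u < u + 1 by rewrite ltrDl.
have h1 : mu.-integrable `]-oo, u + 1] (EFin \o gauss_fun).
  by apply: integrableS integrableT_gauss.
have [||dGu <-] := continuous_FTC1 uu h1; [by rewrite ltNyr|exact: continuous_gauss_fun|].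
by rewrite derive1E; exact: DeriveDef.
Qed.

Lemma gauss_primitive_cvgy : gauss_primitive u @[u --> +oo] --> Num.sqrt pi.
Proof.
apply/cvg_pinftyP => u u_cvg.
have := @cvg_Rintegral_sets R setT gauss_fun (fun n => `]-oo, u n]%classic) setT
      measurableT (fun n => measurable_itv _) measurableT integrableT_gauss.
rewrite setIT (_ : \int[mu]_(x in setT) gauss_fun x = Num.sqrt pi); last first.
  by rewrite /Rintegral integralT_gauss.
move=> h; under eq_fun do rewrite /gauss_primitive -[X in Rintegral _ X _]setTI.
apply: h => x _.
move: u_cvg => /cvgryPge /(_ x); apply: filterS => n xn; split => // _.
Qed.

Lemma gauss_primitive_cvgNy : gauss_primitive u @[u --> -oo] --> (0 : R).
Proof.
apply/cvg_ninftyP => u u_cvg.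
have := @cvg_Rintegral_sets R setT gauss_fun (fun n => `]-oo, u n]%classic) set0
      measurableT (fun n => measurable_itv _) measurable0 integrableT_gauss.
rewrite setI0 Rintegral_set0.
move=> h; under eq_fun do rewrite /gauss_primitive -[X in Rintegral _ X _]setTI.
apply: h => x _.
move: u_cvg => /cvgrNyPlt /(_ x); apply: filterS => n xn; split => //.
by rewrite /= in_itv/= leNgt xn.
Qed.

Section CauchySchlomilch.
Variables (al be : R).
Hypotheses (al0 : 0 < al) (be0 : 0 < be).

Let um y := al * Num.sqrt y - be / Num.sqrt y.
Let up y := al * Num.sqrt y + be / Num.sqrt y.

Let um_0 : um y @[y --> 0^'+] --> -oo.
Proof.
apply/cvgrNyPle => A; near=> y.
have y0 : 0 < y by [].
have s0 : 0 < Num.sqrt y by rewrite sqrtr_gt0.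
have s1 : Num.sqrt y <= 1.
  by rewrite -sqrtr1 ler_sqrt//; near: y; exact: nbhs_right_le.
have s2 : Num.sqrt y <= be / (al + `|A|).
  rewrite -(ger0_norm (_ : 0 <= be / (al + `|A|))); last by rewrite divr_ge0 ?addr_ge0// ltW.
  rewrite -sqrtr_sqr ler_sqrt ?sqr_ge0//; near: y; apply: nbhs_right_le.
  by rewrite exprn_gt0// divr_gt0// ltr_pwDl.
have h1 : al + `|A| <= be / Num.sqrt y.
  by rewrite ler_pdivlMr// mulrC -ler_pdivlMr// ltr_pwDl.
have h2 : al * Num.sqrt y <= al by rewrite ler_piMr// ltW.
rewrite /um.
have : - A <= `|A| by rewrite -normrN ler_norm.
lra.
Unshelve. all: by end_near. Qed.

Let up_0 : up y @[y --> 0^'+] --> +oo.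
Proof.
apply/cvgryPge => A; have /cvgrNyPle /(_ (- A)) := um_0; apply: filterS2 (nbhs_right_gt _).
move=> y y0; rewrite /um /up => h.
have : 0 <= al * Num.sqrt y by rewrite mulr_ge0 ?sqrtr_ge0// ltW.
lra.
Qed.

Let um_y : um y @[y --> +oo] --> +oo.
Proof.
apply/cvgryPge => A; near=> y.
have y1 : 1 <= y by near: y; apply: nbhs_pinfty_ge; rewrite num_real.
have y0 : 0 <= y by exact: le_trans y1.
have s1 : 1 <= Num.sqrt y by rewrite -sqrtr1 ler_sqrt.
have s2 : (`|A| + be) / al <= Num.sqrt y.
  rewrite -[leLHS]ger0_norm; last by rewrite divr_ge0 ?addr_ge0// ltW.
  rewrite -sqrtr_sqr ler_sqrt; last exact: y0.
  by near: y; apply: nbhs_pinfty_ge; rewrite num_real.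
have h1 : `|A| + be <= al * Num.sqrt y by rewrite mulrC -ler_pdivrMr.
have h2 : be / Num.sqrt y <= be.
  by rewrite ler_pdivrMr ?(lt_le_trans ltr01)// ler_peMr// ltW.
have := ler_norm A; rewrite /um; lra.
Unshelve. all: by end_near. Qed.

Let up_y : up y @[y --> +oo] --> +oo.
Proof.
apply/cvgryPge => A; have /cvgryPge /(_ A) := um_y; apply: filterS.
move=> y; rewrite /um /up => h.
have : 0 <= be / Num.sqrt y by rewrite divr_ge0 ?sqrtr_ge0// ltW.
lra.
Qed.

(** With s = sqrt y, (al s -+ be / s)^2 = al^2 y + be^2 / y -+ 2 al be, so both summands
    differentiate to the same exponential times um' and up', and um' + up' = al / s. At 0 [um] tends
    to -oo and [up] to +oo, at +oo both tend to +oo: the [up] terms cancel in the difference of the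
    limits. *)
Let F y := (expR (- (2 * al * be)) * gauss_primitive (um y) +
            expR (2 * al * be) * gauss_primitive (up y)) / al.

Let f y := (Num.sqrt y)^-1 * expR (- (al ^+ 2 * y + be ^+ 2 / y)).

Let dF (y : R) : 0 < y -> is_derive y 1 F (f y).
Proof.
move=> y0; have s0 : 0 < Num.sqrt y by rewrite sqrtr_gt0.
have s1 : Num.sqrt y != 0 by rewrite lt0r_neq0.
have al1 : al != 0 by rewrite lt0r_neq0.
have fE : f y = (Num.sqrt y)^-1 * expR (- (al ^+ 2 * Num.sqrt y ^+ 2 + be ^+ 2 / Num.sqrt y ^+ 2)).
  by rewrite sqr_sqrtr// ltW.
rewrite /F /um /up; apply: hasder_eq.
  apply: hasder_mul; last exact: hasder_cst.
  apply: hasder_add; apply: hasder_mul; try exact: hasder_cst.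
    by apply: hasder_comp; [exact: is_derive_gauss_primitive|derive].
  by apply: hasder_comp; [exact: is_derive_gauss_primitive|derive].
rewrite /= fE /gauss_fun.
set s := Num.sqrt y in s0 s1 *.
rewrite [X in _ = s^-1 * expR X](_ : _ = - (2 * al * be) - (al * s - be / s) ^+ 2); last by field.
rewrite expRD.
rewrite [X in expR (2 * al * be) * (expR X * _)](_ : _ = - (2 * al * be) - (al * s - be / s) ^+ 2 - 2 * al * be); last by field.
rewrite !expRD (expRN (2 * al * be)).
have e0 : expR (2 * al * be) != 0 by rewrite gt_eqF ?expR_gt0.
by field; rewrite e0 s1 al1.
Qed.

Lemma integral_cauchy_schlomilch :
  (\int[mu]_(y in `]0%R, +oo[)
    ((Num.sqrt y)^-1 * expR (- (al ^+ 2 * y + be ^+ 2 / y)))%:E =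
   (Num.sqrt pi / al * expR (- (2 * al * be)))%:E)%E.
Proof.
have F0 : F y @[y --> 0^'+] --> (expR (- (2 * al * be)) * 0 + expR (2 * al * be) * Num.sqrt pi) / al.
  apply: cvgMr_tmp; apply: cvgD; apply: cvgMl_tmp.
    exact: cvg_comp um_0 gauss_primitive_cvgNy.
  exact: cvg_comp up_0 gauss_primitive_cvgy.
have Fy : F y @[y --> +oo] --> (expR (- (2 * al * be)) * Num.sqrt pi + expR (2 * al * be) * Num.sqrt pi) / al.
  apply: cvgMr_tmp; apply: cvgD; apply: cvgMl_tmp.
    exact: cvg_comp um_y gauss_primitive_cvgy.
  exact: cvg_comp up_y gauss_primitive_cvgy.
rewrite (_ : Num.sqrt pi / al * _ = (expR (- (2 * al * be)) * Num.sqrt pi + expR (2 * al * be) * Num.sqrt pi) / al -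
  (expR (- (2 * al * be)) * 0 + expR (2 * al * be) * Num.sqrt pi) / al); last by ring.
apply: (FTC_0y_ge0 f F) => //.
- by move=> y _; rewrite mulr_ge0 ?invr_ge0 ?sqrtr_ge0 ?expR_ge0.
- move=> y y0; have s1 : Num.sqrt y != 0 by rewrite lt0r_neq0// sqrtr_gt0.
  have y1 : y != 0 by rewrite lt0r_neq0.
  by apply: hasder_continuous; derive.
Qed.

End CauchySchlomilch.
End ExplicitIntegrals.

(** * Partial fractions of sech *)

Section SechPartialFractions.
Context {R : realType}.

Lemma hasder_sum (f : nat -> R -> R) (df : nat -> R) (x : R) N :
  (forall n, hasder (f n) x (df n)) ->
  hasder (fun y => \sum_(0 <= n < N) f n y) x (\sum_(0 <= n < N) df n).
Proof.
move=> fd; elim: N => [|N IHN].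
  by under eq_fun do rewrite big_geq//; rewrite big_geq//; exact: hasder_cst.
under eq_fun do rewrite big_nat_recr//=.
by rewrite big_nat_recr//=; exact: hasder_add.
Qed.

(** Mean value inequality with a variable majorant: g - f and g + f are nondecreasing. Choosing [g]
    explicitly replaces integrating the bound on f'. *)
Lemma hasder_dist_le (f g f' g' : R -> R) (a b : R) : a <= b ->
  (forall t, a <= t <= b -> hasder f t (f' t)) ->
  (forall t, a <= t <= b -> hasder g t (g' t)) ->
  (forall t, a <= t <= b -> `|f' t| <= g' t) ->
  `|f b - f a| <= g b - g a.
Proof.
move=> ab df dg fg.
have ndecr (h h' : R -> R) : (forall t, a <= t <= b -> hasder h t (h' t)) ->
    (forall t, a <= t <= b -> 0 <= h' t) -> h a <= h b.
  move=> dh h0; rewrite -subr_ge0.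
  have [] := @MVT_segment R h h' a b ab.
  - by move=> x; rewrite in_itv/= => /andP[ax xb]; apply: dh; rewrite !ltW.
  - apply: continuous_in_subspaceT => x; rewrite inE/= in_itv/= => xab.
    exact: hasder_continuous (dh _ xab).
  - by move=> c; rewrite in_itv/= => /h0 hc ->; rewrite mulr_ge0// subr_ge0.
have h1 := ndecr (fun t => g t - f t) (fun t => g' t - f' t).
have h2 := ndecr (fun t => g t + f t) (fun t => g' t + f' t).
have {}h1 : g a - f a <= g b - f b.
  apply: h1 => t tab.
    by apply: hasder_add; [exact: dg|apply: hasder_opp; exact: df].
  by rewrite subr_ge0 (le_trans (ler_norm _))// fg.
have {}h2 : g a + f a <= g b + f b.
  apply: h2 => t tab; first by apply: hasder_add; [exact: dg|exact: df].
  by rewrite -lerBlDr sub0r (le_trans (ler_norm _))// normrN fg.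
by rewrite ler_norml; apply/andP; split; lra.
Qed.

(** On [0, 1] the derivative of the difference between the partial arctangent series and [atan] is a
    geometric remainder of absolute value at most t^(2N), whose primitive at 1 is 1 / (2N + 1). *)
Lemma leibniz_pi4 N :
  `|\sum_(0 <= n < N) (-1) ^+ n / (2 * n + 1)%:R - pi / 4| <= (2 * N + 1)%:R^-1 :> R.
Proof.
pose f (t : R) := \sum_(0 <= n < N) (-1) ^+ n / (2 * n + 1)%:R * t ^+ (2 * n + 1) - atan t.
pose f' (t : R) := \sum_(0 <= n < N) (- t ^+ 2) ^+ n - (1 + t ^+ 2)^-1.
pose g (t : R) := (2 * N + 1)%:R^-1 * t ^+ (2 * N + 1).
have := @hasder_dist_le f g f' (fun t => t ^+ (2 * N)) 0 1 ler01.
have -> : f 1 = \sum_(0 <= n < N) (-1) ^+ n / (2 * n + 1)%:R - pi / 4.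
  by rewrite /f atan1; congr (_ - _); apply: eq_bigr => n _; rewrite expr1n mulr1.
have -> : f 0 = 0.
  by rewrite /f atan0 subr0; apply: big1 => n _; rewrite addn1 expr0n mulr0.
have -> : g 1 = (2 * N + 1)%:R^-1 by rewrite /g expr1n mulr1.
have -> : g 0 = 0 by rewrite /g addn1 expr0n mulr0.
rewrite !subr0; apply.
- move=> t _; rewrite /f' -[X in _ - X]mulr1; apply: hasder_add.
    apply: hasder_sum => n; apply: (@hasder_eq _ _ _ _ ((- t ^+ 2) ^+ n)); first by derive.
    rewrite /= mulr0 addr0 mulr1 addn1 /= [in RHS]exprNn -exprM.
    by rewrite mulrA divfK// pnatr_eq0.
  by apply: hasder_opp; apply: hasder_atan; exact: hasder_id.
- move=> t _; apply: hasder_eq; first by derive.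
  by rewrite /= mulr0 addr0 mulr1 addn1 /= mulrA mulVf ?mul1r// pnatr_eq0.
- move=> t _.
  have t1 : 0 < 1 + t ^+ 2 by rewrite ltr_pwDl// sqr_ge0.
  have -> : f' t = - (- t ^+ 2) ^+ N / (1 + t ^+ 2).
    rewrite /f'; apply: (mulIf (lt0r_neq0 t1)); rewrite mulrBl divfK ?lt0r_neq0// mulVf ?lt0r_neq0//.
    have := subrX1 (- t ^+ 2) N; rewrite big_mkord; lra.
  rewrite normrM normrN normrX normrN normfV (gtr0_norm t1) (ger0_norm (sqr_ge0 t)) -exprM.
  by rewrite ler_pdivrMr// ler_peMr// ?lerDl ?sqr_ge0// exprM exprn_ge0// sqr_ge0.
Qed.

(** The positive zeros of cos; the poles of sech are at plus or minus i times these numbers. *)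
Definition freq n : R := (2 * n + 1)%:R * pi / 2.

Lemma freqS n : freq n.+1 = freq n + pi.
Proof. by rewrite /freq (_ : 2 * n.+1 + 1 = 2 * n + 1 + 2)%N ?natrD; [field|lia]. Qed.

Lemma freq_gt0 n : 0 < freq n.
Proof. by rewrite !mulr_gt0 ?pi_gt0// ltr0n addn1. Qed.

Lemma sin_freq n : sin (freq n) = (-1) ^+ n.
Proof.
elim: n => [|n IHn]; first by rewrite /freq mul1r sin_pihalf.
by rewrite freqS sinDpi IHn exprS mulN1r.
Qed.

Lemma cos_freq n : cos (freq n) = 0.
Proof.
elim: n => [|n IHn]; first by rewrite /freq mul1r cos_pihalf.
by rewrite freqS cosDpi IHn oppr0.
Qed.

(** The Dirichlet kernel for odd frequencies: multiplication by 2 sin(pi t / 2) makes the sum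
    telescope. *)
Lemma sum_cos_freq N t :
  2 * sin (pi / 2 * t) * \sum_(0 <= n < N) cos (freq n * t) = sin (N%:R * pi * t).
Proof.
elim: N => [|N IHN]; first by rewrite big_geq// mulr0 !mul0r sin0.
rewrite big_nat_recr//= mulrDr IHN.
have -> : N%:R * pi * t = freq N * t - pi / 2 * t by rewrite /freq natrD natrM; field.
have -> : N.+1%:R * pi * t = freq N * t + pi / 2 * t.
  by rewrite /freq natrD natrM -natr1; field.
by rewrite sinB sinD; ring.
Qed.

(** From sin z >= z cos z and 1 - cos z <= sin z one gets (1 + z) sin z >= z, and z <= 2 makes 1 + z
    at most 3. *)
Lemma sin_ge_third (z : R) : 0 <= z <= pi / 2 -> z / 3 <= sin z.
Proof.
move=> /andP[z0 z1].
have zpi : z <= pi by have := @pi_gt0 R; lra.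
have h1 : 0 <= sin z - z * cos z.
  have h := @hasder_dist_le (fun=> 0) (fun u => sin u - u * cos u) (fun=> 0) (fun u => u * sin u) 0 z z0.
  have := le_trans (normr_ge0 _) (h _ _ _); rewrite /= sin0 mul0r !subr0; apply.
  - by move=> t _; exact: hasder_cst.
  - by move=> t _; apply: hasder_eq; [derive|rewrite /=; ring].
  - move=> t /andP[t0 tz]; rewrite normr0 mulr_ge0// sin_ge0_pi// t0/=.
    exact: le_trans zpi.
have s0 : 0 <= sin z by rewrite sin_ge0_pi// z0.
have c0 : 0 <= cos z.
  by rewrite cos_ge0_pihalf// z1 andbT; have := @pi_gt0 R; lra.
have c1 := cos_le1 z; have sc := cos2Dsin2 z.
have h2 : 1 - cos z <= sin z by nra.
have z2 : z <= 2 by have := @pihalf_lt2 R; lra.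
have : z * (1 - sin z) <= z * cos z by rewrite ler_wpM2l//; lra.
nra.
Qed.

Lemma sin_le_id (z : R) : 0 <= z -> `|sin z| <= z.
Proof.
move=> z0; have := @hasder_dist_le sin (fun u => u) cos (fun=> 1) 0 z z0.
rewrite sin0 !subr0; apply.
- by move=> t _; apply: is_derive_sin.
- by move=> t _; exact: hasder_id.
- by move=> t _; exact: cos_max.
Qed.

Section PartialFractions.
Variable x : R.
Hypothesis x0 : 0 < x.

(** The integral over [0, 1] of cosh(x t) cos(w t), for w = [freq n], is (-1)^n w cosh x / (w^2 +
    x^2), and that of cos(w t) is (-1)^n / w. So cosh x times the partial sum for sech, minus a
    multiple of the Leibniz sum, is an integral of cosh(x t) - 1 against a Dirichlet kernel.
    Subtracting 1 tames the zero of sin(pi t / 2) at t = 0 and gives an O(1/N) bound. *)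
Let ch (t : R) := (expR (x * t) + expR (- (x * t))) / 2.
Let sh (t : R) := (expR (x * t) - expR (- (x * t))) / 2.

Let dch t : hasder ch t (x * sh t).
Proof. by apply: hasder_eq; [derive|rewrite /= /sh; field]. Qed.

Let dsh t : hasder sh t (x * ch t).
Proof. by apply: hasder_eq; [derive|rewrite /= /ch; field]. Qed.

Let ch0 : ch 0 = 1. Proof. by rewrite /ch mulr0 oppr0 expR0; field. Qed.
Let sh0 : sh 0 = 0. Proof. by rewrite /sh mulr0 oppr0 expR0; field. Qed.

Let ch_le t : 0 <= t <= 1 -> `|ch t| <= expR x.
Proof.
move=> /andP[t0 t1]; rewrite ger0_norm ?divr_ge0 ?addr_ge0 ?expR_ge0//.
have h1 : expR (x * t) <= expR x by rewrite ler_expR ler_piMr// ltW.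
have h2 : expR (- (x * t)) <= expR x.
  by rewrite ler_expR (@le_trans _ _ 0) ?oppr_le0 ?mulr_ge0// ltW.
rewrite /ch; lra.
Qed.

(** A bound for the second derivative of [ch] on [0, 1]. *)
Let C := x ^+ 2 * expR x.

Let C0 : 0 <= C. Proof. by rewrite mulr_ge0 ?sqr_ge0 ?expR_ge0. Qed.

Let xsh_le t : 0 <= t <= 1 -> `|x * sh t| <= C * t.
Proof.
move=> /andP[t0 t1].
have := @hasder_dist_le (fun u => x * sh u) (fun u => C * u) (fun u => x * (x * ch u)) (fun=> C) 0 t t0.
rewrite sh0 !mulr0 !subr0; apply.
- move=> u _; apply: hasder_eq; first by apply: hasder_mul; [exact: hasder_cst|exact: dsh].
  by rewrite /= mulr0 addr0.
- by move=> u _; apply: hasder_eq; [derive|rewrite /=; ring].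
- move=> u /andP[u0 ut]; rewrite mulrA normrM /C -expr2 (ger0_norm (sqr_ge0 x)).
  by rewrite ler_wpM2l ?sqr_ge0// ch_le// u0 (le_trans ut).
Qed.

Let ch1_le t : 0 <= t <= 1 -> `|ch t - 1| <= C * t ^+ 2.
Proof.
move=> /andP[t0 t1].
have := @hasder_dist_le ch (fun u => C / 2 * u ^+ 2) (fun u => x * sh u) (fun u => C * u) 0 t t0.
rewrite ch0 expr0n/= mulr0 subr0 => h; apply: le_trans (h _ _ _) _.
- by move=> u _; exact: dch.
- by move=> u _; apply: hasder_eq; [derive|rewrite /=; field].
- by move=> u /andP[u0 ut]; rewrite xsh_le// u0 (le_trans ut).
- by rewrite ler_wpM2r ?sqr_ge0//; have := C0; lra.
Qed.

Let s (t : R) := sin (pi / 2 * t).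

Let s_bounds t : 0 <= t <= 1 -> t / 3 <= s t /\ `|s t| <= 2 * t.
Proof.
move=> /andP[t0 t1]; have p1 := @pihalf_ge1 R; have p2 := @pihalf_lt2 R.
have pt0 : 0 <= pi / 2 * t by rewrite mulr_ge0//; lra.
split.
  have : pi / 2 * t <= pi / 2 by rewrite ler_piMr//; lra.
  move=> h; have := @sin_ge_third (pi / 2 * t); rewrite pt0 h => /(_ isT); apply: le_trans.
  by rewrite ler_wpM2r ?invr_ge0// ler_peMl.
by apply: le_trans (sin_le_id _ pt0) _; rewrite ler_wpM2r// ltW.
Qed.

Let g t := (ch t - 1) / s t.
Let g' t := (x * sh t * s t - (ch t - 1) * (pi / 2 * cos (pi / 2 * t))) / (s t) ^+ 2.

Let s_gt0 t : 0 < t <= 1 -> 0 < s t.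
Proof.
move=> /andP[t0 t1]; have t01 : 0 <= t <= 1 by rewrite ltW.
have [h _] := s_bounds _ t01.
by apply: lt_le_trans h; rewrite divr_gt0.
Qed.

Let g_le t : 0 < t <= 1 -> `|g t| <= 3 * C.
Proof.
move=> t01; have /andP[t0 t1] := t01.
have t01' : 0 <= t <= 1 by rewrite ltW.
have [h _] := s_bounds _ t01'; have s0 := s_gt0 _ t01.
rewrite normrM normfV (gtr0_norm s0) ler_pdivrMr//.
apply: le_trans (ch1_le _ t01') _.
have h1 : C * t ^+ 2 <= C * t.
  by rewrite ler_wpM2l ?C0// expr2 ler_piMr// ltW.
apply: le_trans h1 _; have : 3 * C * (t / 3) <= 3 * C * s t.
  by rewrite ler_wpM2l// mulr_ge0.
lra.
Qed.

(** Each of the two terms of the numerator is at most 2 C t^2, and s(t)^2 >= t^2 / 9: hence 4 * 9 =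
    36. *)
Let g'_le t : 0 < t <= 1 -> `|g' t| <= 36 * C.
Proof.
move=> t01; have /andP[t0 t1] := t01.
have t01' : 0 <= t <= 1 by rewrite ltW.
have [h h'] := s_bounds _ t01'; have s0 := s_gt0 _ t01.
have p2 := @pihalf_lt2 R; have p0 := @pihalf_ge1 R.
rewrite normrM normfV (gtr0_norm (exprn_gt0 2 s0)) ler_pdivrMr ?exprn_gt0//.
apply: le_trans (ler_normB _ _) _.
have a1 : `|x * sh t * s t| <= C * t * (2 * t).
  by rewrite normrM ler_pM// xsh_le.
have a2 : `|(ch t - 1) * (pi / 2 * cos (pi / 2 * t))| <= C * t ^+ 2 * 2.
  rewrite normrM ler_pM// ?ch1_le// normrM (ger0_norm (_ : 0 <= pi / 2)); last lra.
  by rewrite -[leRHS]mulr1 ler_pM ?cos_max//; lra.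
have a3 : 36 * C * (t / 3) ^+ 2 <= 36 * C * s t ^+ 2.
  apply: ler_wpM2l; first by rewrite mulr_ge0.
  by apply: lerXn2r => //; rewrite nnegrE ?divr_ge0// ltW.
apply: le_trans (lerD a1 a2) _; apply: le_trans a3.
by rewrite le_eqVlt; apply/orP; left; apply/eqP; field.
Qed.

Let dg t : 0 < t <= 1 -> hasder g t (g' t).
Proof.
move=> t01; have s1 : s t != 0 by rewrite lt0r_neq0// s_gt0.
apply: hasder_eq.
  apply: hasder_mul; first by apply: hasder_add; [exact: dch|exact: hasder_cst].
  by apply: hasder_inv; [exact: s1|rewrite /s; derive].
by rewrite /= /g' /s; field.
Qed.

Section Truncation.
Variable N : nat.
Hypothesis N0 : (0 < N)%N.

(* [K'] is [cosh (x t) - 1] times a Dirichlet kernel [sin (N pi t) / (2 s t)];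
   integrating its oscillating factor gives [H], whose derivative is O(1/N). *)
Let K t := \sum_(0 <= n < N) ((freq n * sin (freq n * t) * ch t + x * cos (freq n * t) * sh t)
    / (freq n ^+ 2 + x ^+ 2) - sin (freq n * t) / freq n).

Let w : R := 2 * N%:R * pi.

Let w0 : 0 < w. Proof. by rewrite !mulr_gt0 ?pi_gt0// ltr0n. Qed.

Let dK t : hasder K t ((ch t - 1) * \sum_(0 <= n < N) cos (freq n * t)).
Proof.
rewrite mulr_sumr; apply: hasder_sum => n.
have f0 := lt0r_neq0 (freq_gt0 n).
have f1 : freq n ^+ 2 + x ^+ 2 != 0.
  by rewrite lt0r_neq0// ltr_wpDl ?sqr_ge0// exprn_gt0.
apply: hasder_eq.
  apply: hasder_add; last by derive.
  apply: hasder_mul; last exact: hasder_cst.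
  by apply: hasder_add; (apply: hasder_mul; [derive|first [exact: dch|exact: dsh]]).
by rewrite /=; field; rewrite ?f0.
Qed.

Let H t := K t + g t * cos (N%:R * pi * t) / w.

Let dH t : 0 < t <= 1 -> hasder H t (g' t * cos (N%:R * pi * t) / w).
Proof.
move=> t01; have s1 : s t != 0 by rewrite lt0r_neq0// s_gt0.
have ww := lt0r_neq0 w0.
apply: hasder_eq.
  apply: hasder_add; first exact: dK.
  apply: hasder_mul; last exact: hasder_cst.
  by apply: hasder_mul; [exact: dg|derive].
rewrite /=.
have E := sum_cos_freq N t; rewrite -/(s t) in E.
have -> : \sum_(0 <= n < N) cos (freq n * t) = sin (N%:R * pi * t) / (2 * s t).
  by rewrite -E; field.
have pi0 : (pi : R) != 0 by rewrite lt0r_neq0// pi_gt0.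
have N1 : N%:R != 0 :> R by rewrite pnatr_eq0 -lt0n.
by rewrite /g /w; move: (pi) pi0 => P P0; field; rewrite ?s1 ?P0 ?N1.
Qed.

(** 36 for the variation of [H], plus 3 for the correction term [g * cos / w] at each of the two
    ends. *)
Let K_le t : 0 < t <= 1 -> `|K 1 - K t| <= 42 * C / w.
Proof.
move=> /andP[t0 t1].
have cw (u v : R) : `|v| <= u -> `|v * cos (N%:R * pi * t) / w| <= u / w.
  move=> vu; rewrite normrM normfV (gtr0_norm w0) ler_wpM2r ?invr_ge0 ?(ltW w0)//.
  by rewrite normrM -[leRHS]mulr1 ler_pM// cos_max.
have h1 : `|H 1 - H t| <= 36 * C / w.
  have dH' u : t <= u <= 1 -> hasder H u (g' u * cos (N%:R * pi * u) / w).
    by move=> /andP[tu u1]; apply: dH; rewrite u1 (lt_le_trans t0).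
  have h := @hasder_dist_le H (fun u => 36 * C / w * u) _ (fun=> 36 * C / w) t 1 t1 dH'.
  apply: le_trans (h _ _) _.
  - by move=> u _; apply: hasder_eq; [derive|rewrite /=; ring].
  - move=> u /andP[tu u1]; rewrite normrM normfV (gtr0_norm w0) ler_wpM2r ?invr_ge0 ?(ltW w0)//.
    by rewrite normrM -[leRHS]mulr1 ler_pM// ?cos_max// g'_le// u1 (lt_le_trans t0).
  - rewrite -mulrBr; apply: ler_piMr; first by apply: divr_ge0; [exact: mulr_ge0|exact: ltW].
    by rewrite gerBl ltW.
have h2 : `|g 1 * cos (N%:R * pi * 1) / w| <= 3 * C / w.
  rewrite normrM normfV (gtr0_norm w0) ler_wpM2r ?invr_ge0 ?(ltW w0)//.
  by rewrite normrM -[leRHS]mulr1 ler_pM// ?cos_max// g_le// ltr01/=.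
have h3 : `|g t * cos (N%:R * pi * t) / w| <= 3 * C / w.
  by apply: cw; rewrite g_le// t0.
have -> : K 1 - K t = (H 1 - H t) - g 1 * cos (N%:R * pi * 1) / w + g t * cos (N%:R * pi * t) / w.
  by rewrite /H; ring.
apply: le_trans (ler_normD _ _) _; apply: le_trans (lerD (ler_normB _ _) (lexx _)) _.
apply: le_trans (lerD (lerD h1 h2) h3) _.
by rewrite le_eqVlt; apply/orP; left; apply/eqP; ring.
Qed.

(** [g] is a quotient 0 / 0 at t = 0, so [K_le] stops short of 0; [K] itself is continuous there and
    vanishes. *)
Let K1_le : `|K 1| <= 42 * C / w.
Proof.
have -> : K 1 = K 1 - K 0.
  rewrite [K 0]big1 ?subr0// => n _.
  by rewrite !mulr0 sin0 sh0 !(mulr0, mul0r) addr0 mul0r subr0.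
have cK : K t @[t --> 0^'+] --> K 0.
  by apply: cvg_at_right_filter; exact: hasder_continuous (dK 0).
have cvK : `|K 1 - K t| @[t --> 0^'+] --> `|K 1 - K 0|.
  by apply: cvg_norm; apply: cvgB => //; exact: cvg_cst.
rewrite -(cvg_lim (@Rhausdorff R) cvK); apply: limr_le; first by apply/cvg_ex; eexists; exact: cvK.
near=> t; apply: K_le; apply/andP; split => //.
by near: t; exact: nbhs_right_le.
Unshelve. all: by end_near. Qed.

Lemma sech_partial_sum_le :
  `|ch 1 * \sum_(0 <= n < N) (-1) ^+ n * (2 * freq n / (freq n ^+ 2 + x ^+ 2))
     - 4 / pi * \sum_(0 <= n < N) (-1) ^+ n / (2 * n + 1)%:R| <= 84 * C / w.
Proof.
suff -> : ch 1 * \sum_(0 <= n < N) (-1) ^+ n * (2 * freq n / (freq n ^+ 2 + x ^+ 2))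
     - 4 / pi * \sum_(0 <= n < N) (-1) ^+ n / (2 * n + 1)%:R = 2 * K 1.
  by rewrite normrM normr_nat; have := K1_le; lra.
rewrite !mulr_sumr -sumrB; apply: eq_bigr => n _.
rewrite !mulr1 sin_freq cos_freq !mulr0 mul0r addr0.
have f1 : freq n ^+ 2 + x ^+ 2 != 0.
  by rewrite lt0r_neq0// ltr_wpDl ?sqr_ge0// exprn_gt0.
have pi0 : (pi : R) != 0 by rewrite lt0r_neq0// pi_gt0.
have n0 : (2 * n + 1)%:R != 0 :> R by rewrite addn1 pnatr_eq0.
have -> : (-1) ^+ n / (2 * n + 1)%:R = (-1) ^+ n * (pi / 2) / freq n.
  by rewrite /freq; move: (pi) pi0 (_%:R) n0 => P P0 k k0; field; rewrite ?k0 ?P0.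
have f0 := lt0r_neq0 (freq_gt0 n).
by move: (pi) pi0 (freq n) f0 f1 => P P0 k f0 f1; field; rewrite ?f0 ?f1 ?P0.
Qed.

End Truncation.

Lemma sech_partial_fractions :
  (fun N => \sum_(0 <= n < N) (-1) ^+ n * (2 * freq n / (freq n ^+ 2 + x ^+ 2)))
    @ \oo --> (cosh x)^-1.
Proof.
have chE : ch 1 = cosh x by rewrite /ch mulr1.
have ch1 : cosh x != 0 by rewrite lt0r_neq0// divr_gt0// addr_gt0 ?expR_gt0.
have pi0 : (pi : R) != 0 by rewrite lt0r_neq0// pi_gt0.
set S := fun N => _; set L := fun N => \sum_(0 <= n < N) (-1) ^+ n / (2 * n + 1)%:R : R.
have inv_cvg : (fun n : nat => n.+1%:R^-1 : R) @ \oo --> (0 : R) by exact: cvg_harmonic.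
have L_cvg : (fun N => L N.+1) @ \oo --> pi / 4.
  apply/subr_cvg0/cvgr0Pnorm_le => e e0 /=.
  have := inv_cvg => /cvgr0_norm_le /(_ e e0); apply: filterS => n; apply: le_trans.
  apply: le_trans (leibniz_pi4 n.+1) _; rewrite ger0_norm// addn1 lef_pV2 ?posrE//.
  by rewrite ler_nat; lia.
have D_cvg : (fun N => cosh x * S N.+1 - 4 / pi * L N.+1) @ \oo --> (0 : R).
  apply/cvgr0Pnorm_le => e e0 /=.
  have h : (fun n : nat => 84 * C / (2 * pi) * n.+1%:R^-1) @ \oo --> (0 : R).
    by rewrite -(mulr0 (84 * C / (2 * pi))); exact: cvgMl_tmp.
  have := h => /cvgr0_norm_le /(_ e e0); apply: filterS => n; apply: le_trans.
  rewrite -chE; apply: le_trans (sech_partial_sum_le n.+1 isT) _.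
  apply: le_trans (ler_norm _); rewrite le_eqVlt; apply/orP; left; apply/eqP.
  have n1 : n.+1%:R != 0 :> R by rewrite pnatr_eq0.
  by move: (n.+1%:R) n1 (pi) pi0 => k k0 P P0; field; rewrite ?P0 ?k0.
(* [sech_partial_sum_le] asks for at least one term, hence the shift. The limit is (1 / cosh x) (0 +
   (4 / pi) (pi / 4)). *)
rewrite -(cvg_shiftn 1)/=; under eq_fun do rewrite addn1.
have -> : (fun N => S N.+1) = (fun N => (cosh x)^-1 * ((cosh x * S N.+1 - 4 / pi * L N.+1) + 4 / pi * L N.+1)).
  by apply/funext => N; rewrite subrK mulKf.
apply: (@cvg_to_eq _ _ _ _ ((cosh x)^-1 * (0 + 4 / pi * (pi / 4)))); last first.
  by move: (pi) pi0 => P P0; field; rewrite ?ch1 ?P0.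
by apply: cvgMl_tmp; apply: cvgD => //; exact: cvgMl_tmp.
Qed.

End PartialFractions.
End SechPartialFractions.

(** * Two transforms of the cube of the eta function *)

Section EtaCube.
Context {R : realType}.
Notation mu := (@lebesgue_measure R).

Definition decay n : R := pi / 4 * (2 * n + 1)%:R ^+ 2.

Definition eta3_term n (y : R) : R := (-1) ^+ n * (2 * n + 1)%:R * expR (- (decay n * y)).

Lemma decay_gt0 n : 0 < decay n.
Proof. by rewrite mulr_gt0 ?divr_gt0 ?pi_gt0// exprn_gt0// addn1. Qed.

(** The cube of q^(1/24) is q^(1/8), and 1/8 + C(n+1,2) = (2n+1)^2 / 8 gives the exponents
    [decay n * y]. *)
Lemma eta3_term_cvg (y : R) : 0 < y ->
  (fun N => \sum_(0 <= n < N) eta3_term n y) @ \oo --> eta_im y ^+ 3.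
Proof.
move=> y0; set q := expR (- (2 * pi * y)).
have q0 : 0 < q by exact: expR_gt0.
have q1 : q < 1 by rewrite expR_lt1 oppr_lt0 !mulr_gt0// pi_gt0.
have -> : eta_im y ^+ 3 = expR (- (pi / 4 * y)) * limn (qfact q) ^+ 3.
  rewrite /eta_im -/q exprMn; congr (_ * _).
  rewrite /q -expRM -expRM_natr; congr expR.
  by move: (pi) => P; field.
have -> : (fun N => \sum_(0 <= n < N) eta3_term n y) =
   (fun N => expR (- (pi / 4 * y)) * series (jacobi_coef q) N).
  apply/funext => N; rewrite /series/= mulr_sumr; apply: eq_bigr => n _.
  rewrite /eta3_term /jacobi_coef /q -expRM_natr.
  transitivity ((-1) ^+ n * (2 * n + 1)%:R * (expR (- (pi / 4 * y)) * expR (- (2 * pi * y) * 'C(n.+1, 2)%:R))); last by ring.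
  rewrite -expRD; congr (_ * expR _).
  have : ('C(n.+1, 2) * 2)%:R = (n.+1 * n)%:R :> R by rewrite binS2_double.
  rewrite /decay natrD !natrM -natr1 => h; have {}h : 'C(n.+1, 2)%:R = (n%:R + 1) * n%:R / 2 :> R by lra.
  by rewrite h; move: (pi) => P; field.
by apply: cvgMl_tmp; exact: jacobi_identity.
Qed.

Lemma eta3_ge0 (y : R) : 0 < y -> 0 <= eta_im y ^+ 3.
Proof.
move=> y0; rewrite exprn_ge0// mulr_ge0 ?powR_ge0//.
apply: ltW; apply: lim_qfact_gt0; first exact: expR_gt0.
by rewrite expR_lt1 oppr_lt0 !mulr_gt0// pi_gt0.
Qed.

Lemma eta3_term_continuous n : continuous (eta3_term n).
Proof. by move=> y; apply: hasder_continuous; rewrite /eta3_term; derive. Qed.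

Lemma measurable_eta3 : measurable_fun (`]0, +oo[ : set R) (fun y : R => eta_im y ^+ 3).
Proof.
apply: (measurable_fun_cvg (h := fun N y => \sum_(0 <= n < N) eta3_term n y)).
  move=> N; apply: measurable_funTS.
  apply: measurable_sum => n; exact: continuous_measurable_fun (@eta3_term_continuous n).
by move=> y /=; rewrite in_itv/= andbT; exact: eta3_term_cvg.
Qed.

(* Abel summation: the partial sums of [(-1) ^ n * (2 n + 1)] are
   [(-1) ^ n * (n + 1)]. *)
Lemma alternating_odd_sum_le (e : nat -> R) N : (forall n, 0 <= e n) -> nonincreasing_seq e ->
  `|\sum_(0 <= n < N) (-1) ^+ n * (2 * n + 1)%:R * e n| <= \sum_(0 <= n < N) e n.
Proof.
move=> e0 ne.
(* This is the claim for the shifted sequence [e n - u], rewritten with the partial sums of the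
   signs. The free [u] makes the induction work: step N + 1 at [u] uses step N at [e N]. *)
suff h u : u <= e N -> 0 <= u -> `|\sum_(0 <= n < N) (-1) ^+ n * (2 * n + 1)%:R * e n
    + (-1) ^+ N * N%:R * u| <= \sum_(0 <= n < N) e n - N%:R * u.
  by have := h 0 (e0 N) (lexx _); rewrite !mulr0 addr0 subr0.
elim: N u => [|N IHN] u ue u0; first by rewrite !big_geq// mulr0 !mul0r addr0 subr0 normr0.
rewrite !big_nat_recr//=.
have := IHN (e N) (lexx _) (e0 N); set S := (\sum_(0 <= n < N) _ * e n); set T := \sum_(0 <= n < N) e n.
move=> h; have uN : u <= e N by apply: le_trans ue _; exact: ne.
have -> : S + (-1) ^+ N * (2 * N + 1)%:R * e N + (-1) ^+ N.+1 * N.+1%:R * u =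
   S + (-1) ^+ N * N%:R * e N + (-1) ^+ N * (N.+1%:R * (e N - u)).
  by rewrite natrD natrM exprS -natr1; ring.
apply: le_trans (ler_normD _ _) _; apply: le_trans (lerD h (lexx _)) _.
rewrite normrM normr_sign mul1r ger0_norm ?mulr_ge0 ?subr_ge0//.
by rewrite -natr1; lra.
Qed.

(** The majorant has lost the factor 2n + 1 of the terms, so its integrals stay summable where those
    of |eta3_term n| do not. *)
Lemma eta3_partial_sum_le N (y : R) : 0 < y ->
  `|\sum_(0 <= n < N) eta3_term n y| <= \sum_(0 <= n < N) expR (- (decay n * y)).
Proof.
move=> y0; apply: alternating_odd_sum_le => [n|]; first exact: expR_ge0.
apply/nonincreasing_seqP => n; rewrite ler_expR lerN2 ler_wpM2r ?(ltW y0)//.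
rewrite ler_wpM2l ?divr_ge0 ?pi_ge0// ler_pXn2r ?nnegrE//.
by rewrite ler_nat; lia.
Qed.

(** Termwise integration for both weights at once: dominated convergence of the partial sums, with
    the sum of the wt y exp(-decay n y) as majorant. *)
Lemma integral_eta3 (wt : R -> R) (I : nat -> R) (M l : R) :
  measurable_fun (`]0, +oo[ : set R) wt -> (forall y : R, 0 < y -> 0 <= wt y) ->
  (forall n, (\int[mu]_(y in `]0%R, +oo[) (wt y * expR (- (decay n * y)))%:E = (I n)%:E)%E) ->
  (forall N, \sum_(0 <= n < N) I n <= M) ->
  (fun N => \sum_(0 <= n < N) (-1) ^+ n * (2 * n + 1)%:R * I n) @ \oo --> l ->
  (\int[mu]_(y in `]0%R, +oo[) (eta_im y ^+ 3 * wt y)%:E = l%:E)%E.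
Proof.
move=> mwt wt0 wtI IM Il.
pose D : set R := `]0, +oo[%classic.
have mD : measurable D by exact: measurable_itv.
have D0 y : D y -> 0 < y by rewrite /D/= in_itv/= andbT.
have mterm n : measurable_fun D (fun y => wt y * expR (- (decay n * y))).
  apply: measurable_funM => //; apply: measurable_funTS; apply: continuous_measurable_fun.
  by move=> y; apply: hasder_continuous; derive.
have term0 n y : D y -> (0 <= (wt y * expR (- (decay n * y)))%:E)%E.
  by move=> /D0 y0; rewrite lee_fin mulr_ge0 ?expR_ge0 ?wt0.
have iterm n : mu.-integrable D (fun y => (wt y * expR (- (decay n * y)))%:E).
  apply/integrableP; split; first by apply/measurable_EFinP; exact: mterm.
  rewrite (_ : (\int[mu]_(y in D) _)%E = (I n)%:E) ?ltry// -wtI.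
  by apply: eq_integral => y /set_mem yD; rewrite gee0_abs// term0.
(* Taken in the extended reals, the majorant exists for every y; by monotone convergence its
   integral is the sum of the [I n], at most [M]. *)
pose g y : \bar R := (\sum_(0 <= n <oo) (wt y * expR (- (decay n * y)))%:E)%E.
have mg : measurable_fun D g.
  apply: (emeasurable_fun_cvg (fun N y => \sum_(0 <= n < N) (wt y * expR (- (decay n * y)))%:E)%E).
    by move=> N; apply: emeasurable_sum => n; apply/measurable_EFinP; exact: mterm.
  by move=> y Dy; apply: is_cvg_nneseries => n _ _; exact: term0.
have g0 y : D y -> (0 <= g y)%E by move=> Dy; apply: nneseries_ge0 => n _ _; exact: term0.
have ig : mu.-integrable D g.
  apply/integrableP; split => //.
  rewrite (_ : (\int[mu]_(y in D) _)%E = (\sum_(0 <= n <oo) (I n)%:E)%E).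
    apply: (@le_lt_trans _ _ M%:E); last exact: ltry.
    apply: lime_le; last by apply: nearW => N; rewrite sumEFin lee_fin.
    apply: is_cvg_nneseries => n _ _; rewrite -wtI.
    by apply: integral_ge0 => y; exact: term0.
  under [in RHS]eq_eseriesr do rewrite -wtI.
  rewrite -integral_nneseries//; last by move=> n; apply/measurable_EFinP; exact: mterm.
  by apply: eq_integral => y /set_mem yD; rewrite gee0_abs// g0.
pose T N (y : R) := \sum_(0 <= n < N) eta3_term n y * wt y.
have mT N : measurable_fun D (EFin \o T N).
  apply/measurable_EFinP/measurable_sum => n; apply: measurable_funM => //.
  by apply: measurable_funTS; exact: continuous_measurable_fun (@eta3_term_continuous n).
have mE : measurable_fun D (fun y => (eta_im y ^+ 3 * wt y)%:E).
  by apply/measurable_EFinP/measurable_funM => //; exact: measurable_eta3.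
have cT : {ae mu, forall y, D y -> (EFin \o T N) y @[N --> \oo] --> (eta_im y ^+ 3 * wt y)%:E}.
  apply: aeW => y /D0 y0; apply: cvg_EFin; first exact: nearW.
  rewrite /T/=; under eq_fun do rewrite -mulr_suml.
  by apply: cvgMr_tmp; exact: eta3_term_cvg.
have bT : {ae mu, forall y, forall N, D y -> (`|(EFin \o T N) y| <= g y)%E}.
  apply: aeW => y N Dy; have y0 := D0 y Dy.
  apply: (@le_trans _ _ (\sum_(0 <= n < N) (wt y * expR (- (decay n * y)))%:E)%E); last first.
    by apply: nneseries_lim_ge => n _ _; exact: term0.
  rewrite sumEFin /= lee_fin /T -mulr_suml -mulr_sumr mulrC normrM ger0_norm ?wt0//.
  by rewrite ler_wpM2l ?wt0// eta3_partial_sum_le.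
have [_ _] := @dominated_convergence _ _ R mu D mD (fun N => EFin \o T N)
  (fun y => (eta_im y ^+ 3 * wt y)%:E) g mT mE cT ig bT.
have -> : [sequence (\int[mu]_(y in D) (EFin \o T N) y)%E]_N =
    (fun N => (\sum_(0 <= n < N) (-1) ^+ n * (2 * n + 1)%:R * I n)%:E).
  apply/funext => N /=; rewrite /T; under eq_integral do rewrite -sumEFin.
  have tE n y : (eta3_term n y * wt y)%:E =
      (((-1) ^+ n * (2 * n + 1)%:R)%:E * (wt y * expR (- (decay n * y)))%:E)%E.
    by rewrite -EFinM /eta3_term; congr EFin; ring.
  rewrite integral_sum//; last first.
    by move=> n; under eq_fun do rewrite tE; exact: integrableZl.
  rewrite -sumEFin; apply: eq_bigr => n _.
  by under eq_integral do rewrite tE; rewrite integralZl// wtI.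
move=> /(cvg_lim (@ereal_hausdorff R)) <-; apply: cvg_lim => //.
by apply: cvg_EFin; [exact: nearW|exact: Il].
Qed.

Section Weights.
Variable x : R.
Hypothesis x0 : 0 < x.

Let pi0 : (pi : R) != 0. Proof. by rewrite lt0r_neq0// pi_gt0. Qed.

Let x2pi : 0 < x ^+ 2 / pi. Proof. by rewrite divr_gt0 ?exprn_gt0// pi_gt0. Qed.

Lemma integral_eta3_expN :
  (\int[mu]_(y in `]0%R, +oo[) (eta_im y ^+ 3 * expR (- (x ^+ 2 / pi * y)))%:E =
   ((cosh x)^-1)%:E)%E.
Proof.
pose I n := (decay n + x ^+ 2 / pi)^-1.
have dx n : 0 < decay n + x ^+ 2 / pi by rewrite addr_gt0// decay_gt0.
apply: (@integral_eta3 _ I 4).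
- apply: measurable_funTS; apply: continuous_measurable_fun.
  by move=> y; apply: hasder_continuous; derive.
- by move=> y _; exact: expR_ge0.
- move=> n; rewrite -integral_expN//; apply: eq_integral => y _.
  by rewrite -expRD; congr (expR _)%:E; ring.
(* A telescoping majorant: pi >= 2 gives I N <= 2 / (2N+1)^2, which is at most 4 / (N+1) - 4 /
   (N+2), with equality at N = 0. *)
- move=> N; apply: (@le_trans _ _ (4 - 4 / N.+1%:R)); last by rewrite gerBl divr_ge0.
  elim: N => [|N IHN]; first by rewrite big_geq// divr1 subrr.
  rewrite big_nat_recr//=; apply: le_trans (lerD IHN (lexx _)) _.
  have h : I N <= 2 / (2 * N + 1)%:R ^+ 2.
    have k0 : 0 < (2 * N + 1)%:R ^+ 2 :> R by rewrite exprn_gt0// addn1.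
    rewrite /I -[leLHS]div1r ler_pdivrMr// mulrAC ler_pdivlMr// mul1r /decay.
    have := @pi_ge2 R; have := ltW x2pi; nra.
  apply: le_trans (lerD (lexx _) h) _.
  have n0 : (0 : R) <= N%:R by [].
  rewrite (_ : N.+2%:R = N%:R + 1 + 1 :> R); last by rewrite !natr1.
  rewrite (_ : N.+1%:R = N%:R + 1 :> R); last by rewrite natr1.
  rewrite natrD natrM.
  have h1 : (0 : R) < N%:R + 1 by rewrite ltr_wpDl.
  have h2 : (0 : R) < N%:R + 1 + 1 by rewrite ltr_wpDl// ltW.
  have h3 : (0 : R) < 2 * N%:R + 1 by rewrite ltr_wpDl// mulr_ge0.
  rewrite -subr_ge0.
  have -> : 4 - 4 / (N%:R + 1 + 1) - (4 - 4 / (N%:R + 1) + 2 / (2 * N%:R + 1) ^+ 2) =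
     (14 * N%:R ^+ 2 + 10 * N%:R) / ((N%:R + 1) * (N%:R + 1 + 1) * (2 * N%:R + 1) ^+ 2) :> R.
    by field; rewrite ?(lt0r_neq0 h1) ?(lt0r_neq0 h2) ?(lt0r_neq0 h3).
  by rewrite divr_ge0 ?mulr_ge0 ?addr_ge0 ?mulr_ge0 ?exprn_ge0 ?(ltW h1) ?(ltW h2) ?(ltW h3).
- rewrite (_ : (fun _ => _) = fun N => \sum_(0 <= n < N) (-1) ^+ n * (2 * freq n / (freq n ^+ 2 + x ^+ 2))).
    exact: sech_partial_fractions.
  apply/funext => N; apply: eq_bigr => n _; rewrite -mulrA; congr (_ * _).
  rewrite /I /freq; have := lt0r_neq0 (dx n); rewrite /decay.
  have f1 : ((2 * n + 1)%:R * pi / 2) ^+ 2 + x ^+ 2 != 0 :> R.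
    by rewrite lt0r_neq0// ltr_wpDl ?sqr_ge0// exprn_gt0.
  move: (_%:R) (pi) pi0 f1 => k P P0 f1 d1.
  have d2 : P / 4 * k ^+ 2 * P + x ^+ 2 != 0.
    by rewrite (_ : _ + _ = (k * P / 2) ^+ 2 + x ^+ 2)//; field.
  have -> : P / 4 * k ^+ 2 + x ^+ 2 / P = ((k * P / 2) ^+ 2 + x ^+ 2) / P by field.
  move: (_ ^+ 2 + _ ^+ 2) f1 => D D0.
  by rewrite invf_div; field; rewrite ?D0 ?P0.
Qed.

Lemma integral_eta3_expN_inv :
  (\int[mu]_(y in `]0%R, +oo[)
     (eta_im y ^+ 3 * ((Num.sqrt y)^-1 * expR (- (x ^+ 2 / pi / y))))%:E =
   ((cosh x)^-1)%:E)%E.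
Proof.
pose k n : R := (2 * n + 1)%:R.
have k0 n : 0 < k n by rewrite /k addn1.
pose I n := 2 / k n * expR (- (k n * x)).
have E1 : expR (- (2 * x)) < 1 by rewrite expR_lt1 oppr_lt0 mulr_gt0.
pose z := expR (- (2 * x)).
have z0 : 0 < z by exact: expR_gt0.
have IE n : expR (- (k n * x)) = expR (- x) * z ^+ n.
  by rewrite /z -expRM_natr -expRD /k natrD natrM; congr expR; ring.
have sp0 : 0 < Num.sqrt pi :> R by rewrite sqrtr_gt0 pi_gt0.
have sp2 : Num.sqrt pi ^+ 2 = pi :> R by rewrite sqr_sqrtr// pi_ge0.
apply: (@integral_eta3 _ I (limn (series (geometric (2 * expR (- x)) z)))).
- apply: open_continuous_measurable_fun; first exact: interval_open.
  move=> y; rewrite inE/= in_itv/= andbT => y0.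
  have y1 : y != 0 by rewrite lt0r_neq0.
  have s1 : Num.sqrt y != 0 by rewrite lt0r_neq0// sqrtr_gt0.
  by apply: hasder_continuous; derive.
- by move=> y _; rewrite mulr_ge0 ?invr_ge0 ?sqrtr_ge0 ?expR_ge0.
- move=> n.
  (* Chosen so that al^2 = decay n and be^2 = x^2 / pi; then 2 al be = (2n+1) x and sqrt pi / al = 2
     / (2n+1), which cancels the coefficient 2n + 1 and leaves a geometric series. *)
  have := @integral_cauchy_schlomilch R (Num.sqrt pi * k n / 2) (x / Num.sqrt pi).
  rewrite !divr_gt0 ?mulr_gt0// => /(_ isT isT) h.
  transitivity ((Num.sqrt pi / (Num.sqrt pi * k n / 2) *
      expR (- (2 * (Num.sqrt pi * k n / 2) * (x / Num.sqrt pi))))%:E); last first.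
    have := lt0r_neq0 sp0; have := lt0r_neq0 (k0 n); rewrite /I.
    move: (Num.sqrt pi) (k n) => P kn kn0 P0; congr (_ * expR _)%:E; field; rewrite ?kn0 ?P0//.
  rewrite -h; apply: eq_integral => y; rewrite inE/= in_itv/= andbT => y0.
  rewrite -(mulrA (Num.sqrt y)^-1) -expRD; congr (_ * expR _)%:E.
  rewrite !expr_div_n exprMn sp2 /decay -/(k n).
  by have := lt0r_neq0 y0; have := pi0; move: (pi) (k n) => P kn P0 y1; field; rewrite ?P0 ?y1.
- move=> N; have cg : cvgn (series (geometric (2 * expR (- x)) z)).
    by apply: is_cvg_geometric_series; rewrite gtr0_norm.
  apply: le_trans (nondecreasing_cvgn_le _ cg N); last first.
    apply: nondecreasing_series => n _ _.
    by rewrite /geometric/= mulr_ge0 ?exprn_ge0 ?mulr_ge0 ?expR_ge0.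
  rewrite /series/=; apply: ler_sum => n _; rewrite /I IE mulrA ler_wpM2r ?exprn_ge0 ?expR_ge0//.
  rewrite ler_wpM2r ?expR_ge0// ler_pdivrMr// ler_peMr//.
  by rewrite /k ler1n addn1.
- rewrite (_ : (fun _ => _) = series (geometric (2 * expR (- x)) (- z))).
    apply: (@cvg_to_eq _ _ _ _ (2 * expR (- x) * (1 - - z)^-1)).
      by apply: cvg_geometric_series; rewrite normrN gtr0_norm.
    rewrite /cosh invf_div -mulrA; congr (2 * _).
    have -> : 1 - - z = (expR x + expR (- x)) * expR (- x).
      by rewrite opprK mulrDl -!expRD subrr expR0 /z; congr (_ + expR _); ring.
    have := lt0r_neq0 (addr_gt0 (expR_gt0 x) (expR_gt0 (- x))).
    by have := lt0r_neq0 (expR_gt0 (- x)); move=> e1 e2; field; rewrite ?e1 ?e2.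
  apply/funext => N; rewrite /series/=; apply: eq_bigr => n _.
  rewrite /I IE -/(k n) /geometric/= [in RHS]exprNn; have := lt0r_neq0 (k0 n); move: (k n) => kn kn0.
  by field.
Qed.

End Weights.
End EtaCube.

(** * The Gamma integral in the right half-plane *)

Section GammaIntegrals.
Context {R : realType}.
Notation mu := (@lebesgue_measure R).
Implicit Types (sg tau r s : R).

(* [gcos + i gsin] is [u `^ (p - 1) * exp (- w u)] for [p = sg + i tau] and
   [w = r + i s]. *)
Definition gabs sg r (u : R) : R := expR ((sg - 1) * ln u - r * u).
Definition gcos sg tau r s (u : R) : R := gabs sg r u * cos (tau * ln u - s * u).
Definition gsin sg tau r s (u : R) : R := gabs sg r u * sin (tau * ln u - s * u).

Lemma gabs_ge0 sg r u : 0 <= gabs sg r u. Proof. exact: expR_ge0. Qed.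

Lemma gabsS sg r u : 0 < u -> gabs (sg + 1) r u = u * gabs sg r u.
Proof.
move=> u0; rewrite /gabs -{3}(lnK u0) -expRD; congr expR; ring.
Qed.

Lemma gabs_cvg0 sg r : 0 < sg -> gabs (sg + 1) r u @[u --> 0^'+] --> (0 : R).
Proof.
move=> sg0; apply/cvgr0Pnorm_le => e e0.
have := @lnNy R => /cvgrNyPle /(_ ((ln e - `|r|) / sg)) h.
near=> u.
have u0 : 0 < u by [].
have u1 : u <= 1 by near: u; exact: nbhs_right_le.
have hu : ln u <= (ln e - `|r|) / sg by near: u.
rewrite ger0_norm ?gabs_ge0// /gabs -(lnK e0) ler_expR addrK.
move: hu; rewrite ler_pdivlMr// mulrC => hu.
have : - (r * u) <= `|r|.
  apply: le_trans (ler_norm _) _; rewrite normrN normrM -[leRHS]mulr1.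
  by rewrite ler_wpM2l// gtr0_norm.
lra.
Unshelve. all: by end_near. Qed.

(** Rescale by the maximum point, u = (a / r) v, and use ln v <= v. *)
Lemma ln_lin_bound (a r u : R) : 0 < a -> 0 < r -> 0 < u -> a * ln u - r * u <= a * ln (a / r).
Proof.
move=> a0 r0 u0; have ar0 : 0 < a / r by exact: divr_gt0.
rewrite (_ : u = a / r * (r / a * u)); last by field; rewrite ?(lt0r_neq0 a0) ?(lt0r_neq0 r0).
have v0 : 0 < r / a * u by rewrite mulr_gt0// divr_gt0.
rewrite lnM ?posrE//; have := ltW (ln_sublinear v0).
move: (r / a * u) v0 => v v0 h.
have -> : r * (a / r * v) = a * v by field; rewrite ?(lt0r_neq0 r0).
have := ler_wpM2l (ltW a0) h; lra.
Qed.

Lemma gabs_cvgy sg r : 0 < sg -> 0 < r -> gabs (sg + 1) r u @[u --> +oo] --> (0 : R).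
Proof.
move=> sg0 r0; apply/cvgr0Pnorm_le => e e0.
(* Half of the exponential decay pays for the power of u, the other half tends to 0. *)
have r20 : 0 < r / 2 by rewrite divr_gt0.
near=> u.
have u0 : 0 < u by near: u; apply: nbhs_pinfty_gt; rewrite num_real.
rewrite ger0_norm ?gabs_ge0// /gabs -(lnK e0) ler_expR addrK.
have := ln_lin_bound _ _ _ sg0 r20 u0; set K := sg * ln (sg / (r / 2)) => h.
have : (K - ln e) / (r / 2) <= u by near: u; apply: nbhs_pinfty_ge; rewrite num_real.
by rewrite ler_pdivrMr//; lra.
Unshelve. all: by end_near. Qed.

Lemma gabs_continuous sg r (u : R) : 0 < u -> {for u, continuous (gabs sg r)}.
Proof. by move=> u0; apply: hasder_continuous; rewrite /gabs; derive. Qed.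

Lemma gcos_continuous sg tau r s (u : R) : 0 < u -> {for u, continuous (gcos sg tau r s)}.
Proof. by move=> u0; apply: hasder_continuous; rewrite /gcos /gabs; derive. Qed.

Lemma gsin_continuous sg tau r s (u : R) : 0 < u -> {for u, continuous (gsin sg tau r s)}.
Proof. by move=> u0; apply: hasder_continuous; rewrite /gsin /gabs; derive. Qed.

Lemma continuous_measurable_pos (f : R -> R) : (forall u : R, 0 < u -> {for u, continuous f}) ->
  measurable_fun (`]0, +oo[ : set R) f.
Proof.
move=> cf; apply: open_continuous_measurable_fun; first exact: interval_open.
by move=> x; rewrite inE/= in_itv/= andbT => /cf.
Qed.

Lemma dominated_integrable_pos (f g : R -> R) : (forall u : R, 0 < u -> {for u, continuous f}) ->
  mu.-integrable `]0, +oo[ (EFin \o g) -> (forall u : R, 0 < u -> `|f u| <= g u) ->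
  mu.-integrable `]0, +oo[ (EFin \o f).
Proof.
move=> cf ig fg; apply: le_integrable ig => //.
  by apply/measurable_EFinP; exact: continuous_measurable_pos.
move=> u /=; rewrite in_itv/= andbT => u0; rewrite lee_fin.
by apply: le_trans (ler_norm _); exact: fg.
Qed.

(* The majorant is a multiple of the derivative of the bounded function
   [u `^ sg / (1 + u `^ sg)]. *)
Lemma gabs_integrable sg r : 0 < sg -> 0 < r -> mu.-integrable `]0, +oo[ (EFin \o gabs sg r).
Proof.
move=> sg0 r0.
pose v (u : R) := expR (sg * ln u).
have v0 u : 0 < v u by exact: expR_gt0.
have v1 u : 0 < 1 + v u by rewrite addr_gt0.
pose F u := - (1 + v u)^-1 / sg.
pose f u := expR ((sg - 1) * ln u) / (1 + v u) ^+ 2.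
have cf (u : R) : 0 < u -> {for u, continuous f}.
  move=> u0; have h : (1 + v u) ^+ 2 != 0 by rewrite lt0r_neq0// exprn_gt0.
  by apply: hasder_continuous; rewrite /f /v in h *; derive.
have dF (u : R) : 0 < u -> is_derive u 1 F (f u).
  move=> u0; have h : 1 + expR (sg * ln u) != 0 by have := v1 u; exact: lt0r_neq0.
  have sg1 := lt0r_neq0 sg0; have u1 := lt0r_neq0 u0.
  apply: hasder_eq; first by rewrite /F /v; derive.
  rewrite /= /f /v mulrBl expRB mul1r lnK//.
  by field; rewrite ?h ?sg1 ?u1.
have F0 : F u @[u --> 0^'+] --> - 1 / sg.
  have cv : v u @[u --> 0^'+] --> (0 : R).
    apply/cvgr0Pnorm_le => e e0.
    have := @lnNy R => /cvgrNyPle /(_ (ln e / sg)); apply: filterS => u.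
    by rewrite ler_pdivlMr// gtr0_norm ?v0// /v -[X in _ -> _ <= X](lnK e0) ler_expR mulrC.
  apply: cvgMr_tmp; apply: cvgN.
  apply: (@cvg_to_eq _ _ _ _ ((1 + 0)^-1)); last by rewrite addr0 invr1.
  apply: cvgV; first by rewrite addr0 oner_neq0.
  exact: (cvgD (cvg_cst (1 : R)) cv).
have Fy : F u @[u --> +oo] --> (0 : R).
  apply/cvgr0Pnorm_le => e e0.
  have e1 : 0 < (e * sg)^-1 by rewrite invr_gt0 mulr_gt0.
  near=> u.
  have u0 : 0 < u by near: u; apply: nbhs_pinfty_gt; rewrite num_real.
  rewrite /F normrM normrN !normfV (gtr0_norm (v1 u)) (gtr0_norm sg0).
  rewrite ler_pdivrMr// -[leRHS]invrK lef_pV2 ?posrE//.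
  have h : expR (ln (e * sg)^-1 / sg) <= u by near: u; apply: nbhs_pinfty_ge; rewrite num_real.
  apply: (@le_trans _ _ (v u)); last by rewrite lerDr.
  have h' : ln (e * sg)^-1 / sg <= ln u by rewrite -ler_expR (lnK u0).
  by rewrite /v -[leLHS](lnK e1) ler_expR [leRHS]mulrC -ler_pdivrMr.
have if_ : mu.-integrable `]0, +oo[ (EFin \o f).
  by apply: (FTC_0y_ge0_integrable f F _ _ _ cf dF F0 Fy) => u _; rewrite divr_ge0 ?expR_ge0 ?exprn_ge0 ?(ltW (v1 u)).
(* exp(-r u) (1 + v)^2 is bounded by [M]: (1 + v)^2 <= 2 + 2 v^2, exp(-r u) <= 1, and [ln_lin_bound]
   bounds exp(-r u) v^2. *)
pose M := 2 + 2 * expR (2 * sg * ln (2 * sg / r)).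
have iM : mu.-integrable `]0, +oo[ (EFin \o (fun u => M * f u)).
  by apply: eq_integrable (integrableZl _ M if_) => //.
apply: (dominated_integrable_pos _ _ (gabs_continuous sg r) iM) => u u0.
rewrite ger0_norm ?gabs_ge0// /gabs /f expRD mulrCA ler_wpM2l ?expR_ge0//.
rewrite ler_pdivlMr ?exprn_gt0//.
have sg20 : 0 < 2 * sg by rewrite mulr_gt0.
have h := ln_lin_bound _ _ _ sg20 r0 u0.
have h1 : expR (- (r * u)) * v u ^+ 2 <= expR (2 * sg * ln (2 * sg / r)).
  by rewrite /v -expRM_natr -expRD ler_expR; lra.
have h2 : expR (- (r * u)) <= 1.
  by rewrite expR_le1 oppr_le0 mulr_ge0// ltW.
have h3 : (1 + v u) ^+ 2 <= 2 + 2 * v u ^+ 2 by have := sqr_ge0 (1 - v u); lra.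
apply: le_trans (ler_wpM2l (expR_ge0 _) h3) _; rewrite /M; lra.
Unshelve. all: by end_near. Qed.

Lemma gcos_integrable sg tau r s : 0 < sg -> 0 < r ->
  mu.-integrable `]0, +oo[ (EFin \o gcos sg tau r s).
Proof.
move=> sg0 r0; apply: (dominated_integrable_pos _ _ (gcos_continuous sg tau r s) (gabs_integrable _ _ sg0 r0)).
by move=> u _; rewrite normrM (ger0_norm (gabs_ge0 _ _ _)) ler_piMr ?gabs_ge0// cos_max.
Qed.

Lemma gsin_integrable sg tau r s : 0 < sg -> 0 < r ->
  mu.-integrable `]0, +oo[ (EFin \o gsin sg tau r s).
Proof.
move=> sg0 r0; apply: (dominated_integrable_pos _ _ (gsin_continuous sg tau r s) (gabs_integrable _ _ sg0 r0)).
by move=> u _; rewrite normrM (ger0_norm (gabs_ge0 _ _ _)) ler_piMr ?gabs_ge0// sin_max.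
Qed.

End GammaIntegrals.

(** * Functional equation and change of scale by a complex number *)

Section GammaIdentities.
Context {R : realType}.
Notation mu := (@lebesgue_measure R).
Implicit Types (sg tau r s : R).

Definition Gcos sg tau r s : R := \int[mu]_(u in `]0, +oo[) gcos sg tau r s u.
Definition Gsin sg tau r s : R := \int[mu]_(u in `]0, +oo[) gsin sg tau r s u.

Let int_cvg0 sg tau r s (F : R -> R) (trig : R -> R) :
  0 < sg -> 0 < r -> (forall z, `|trig z| <= 1) ->
  (forall u, F u = gabs (sg + 1) r u * trig (tau * ln u - s * u)) ->
  F u @[u --> 0^'+] --> (0 : R) /\ F u @[u --> +oo] --> (0 : R).
Proof.
move=> sg0 r0 trig1 FE.
have le u : `|F u| <= gabs (sg + 1) r u.
  by rewrite FE normrM (ger0_norm (gabs_ge0 _ _ _)) ler_piMr ?gabs_ge0.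
split; apply/cvgr0Pnorm_le => e e0.
  have := gabs_cvg0 _ r sg0 => /cvgr0Pnorm_le /(_ e e0); apply: filterS => u.
  by apply: le_trans; apply: le_trans (le u) (ler_norm _).
have := gabs_cvgy _ _ sg0 r0 => /cvgr0Pnorm_le /(_ e e0); apply: filterS => u.
by apply: le_trans; apply: le_trans (le u) (ler_norm _).
Qed.

(** Four terms are what integration by parts needs in components; shorter combinations take zero
    coefficients. *)
Lemma integral_lin4 (f1 f2 f3 f4 : R -> R) (a b c d : R) :
  mu.-integrable `]0, +oo[ (EFin \o f1) -> mu.-integrable `]0, +oo[ (EFin \o f2) ->
  mu.-integrable `]0, +oo[ (EFin \o f3) -> mu.-integrable `]0, +oo[ (EFin \o f4) ->
  mu.-integrable `]0, +oo[ (EFin \o (fun u => (a * f1 u + b * f2 u) + (c * f3 u + d * f4 u))) /\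
  \int[mu]_(u in `]0, +oo[) ((a * f1 u + b * f2 u) + (c * f3 u + d * f4 u)) =
  (a * (\int[mu]_(u in `]0, +oo[) f1 u) + b * (\int[mu]_(u in `]0, +oo[) f2 u)) +
  (c * (\int[mu]_(u in `]0, +oo[) f3 u) + d * (\int[mu]_(u in `]0, +oo[) f4 u)).
Proof.
move=> i1 i2 i3 i4.
have iZ (k : R) f : mu.-integrable `]0, +oo[ (EFin \o f) ->
    mu.-integrable `]0, +oo[ (EFin \o (fun u => k * f u)).
  by move=> fi; apply: eq_integrable (integrableZl _ k fi) => //.
have iD f g : mu.-integrable `]0, +oo[ (EFin \o f) -> mu.-integrable `]0, +oo[ (EFin \o g) ->
    mu.-integrable `]0, +oo[ (EFin \o (fun u => f u + g u)).
  by move=> fi gi; apply: eq_integrable (integrableD _ fi gi) => //.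
have j1 := iZ a _ i1; have j2 := iZ b _ i2; have j3 := iZ c _ i3; have j4 := iZ d _ i4.
have k1 := iD _ _ j1 j2; have k2 := iD _ _ j3 j4.
split; first exact: iD.
by rewrite (RintegralD _ k1 k2)// (RintegralD _ j1 j2)// (RintegralD _ j3 j4)// !RintegralZl.
Qed.

(** Write I(p) for the integral of u^(p-1) exp(-w u). This is the real part of p I(p) = w I(p+1):
    u^p exp(-w u) vanishes at both ends. *)
Lemma Gamma_by_parts_cos sg tau r s : 0 < sg -> 0 < r ->
  sg * Gcos sg tau r s - tau * Gsin sg tau r s =
  r * Gcos (sg + 1) tau r s - s * Gsin (sg + 1) tau r s.
Proof.
move=> sg0 r0; have sg10 : 0 < sg + 1 by exact: addr_gt0.
pose F u := gabs (sg + 1) r u * cos (tau * ln u - s * u).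
have [F0 Fy] := int_cvg0 sg tau r s F cos sg0 r0 (@cos_max R) (fun _ => erefl).
have [fi fE] := integral_lin4 _ _ _ _ sg (- tau) (- r) s (gcos_integrable sg tau r s sg0 r0)
  (gsin_integrable sg tau r s sg0 r0) (gcos_integrable _ tau r s sg10 r0) (gsin_integrable _ tau r s sg10 r0).
pose f u := (sg * gcos sg tau r s u + - tau * gsin sg tau r s u) +
  (- r * gcos (sg + 1) tau r s u + s * gsin (sg + 1) tau r s u).
have cf (u : R) : 0 < u -> {for u, continuous f}.
  by move=> u0; apply: hasder_continuous; rewrite /f /gcos /gsin /gabs; derive.
have dF (u : R) : 0 < u -> is_derive u 1 F (f u).
  move=> u0; have u1 := lt0r_neq0 u0.
  apply: hasder_eq; first by rewrite /F /gabs; derive.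
  rewrite /= /f /gcos /gsin !gabsS//.
  have -> : expR ((sg + 1 - 1) * ln u - r * u) = u * gabs sg r u by rewrite -gabsS.
  by field; rewrite ?u1.
have := FTC_0y f F _ _ cf dF F0 Fy fi.
rewrite fE -!/(Gcos _ _ _ _) -!/(Gsin _ _ _ _) {fi fE}.
by move: (Gcos _ _ _ _) (Gcos _ _ _ _) (Gsin _ _ _ _) (Gsin _ _ _ _) => A B C E; clear; lra.
Qed.

(** The imaginary part of the same identity. *)
Lemma Gamma_by_parts_sin sg tau r s : 0 < sg -> 0 < r ->
  tau * Gcos sg tau r s + sg * Gsin sg tau r s =
  s * Gcos (sg + 1) tau r s + r * Gsin (sg + 1) tau r s.
Proof.
move=> sg0 r0; have sg10 : 0 < sg + 1 by exact: addr_gt0.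
pose F u := gabs (sg + 1) r u * sin (tau * ln u - s * u).
have [F0 Fy] := int_cvg0 sg tau r s F sin sg0 r0 (@sin_max R) (fun _ => erefl).
have [fi fE] := integral_lin4 _ _ _ _ tau sg (- s) (- r) (gcos_integrable sg tau r s sg0 r0)
  (gsin_integrable sg tau r s sg0 r0) (gcos_integrable _ tau r s sg10 r0) (gsin_integrable _ tau r s sg10 r0).
pose f u := (tau * gcos sg tau r s u + sg * gsin sg tau r s u) +
  (- s * gcos (sg + 1) tau r s u + - r * gsin (sg + 1) tau r s u).
have cf (u : R) : 0 < u -> {for u, continuous f}.
  by move=> u0; apply: hasder_continuous; rewrite /f /gcos /gsin /gabs; derive.
have dF (u : R) : 0 < u -> is_derive u 1 F (f u).
  move=> u0; have u1 := lt0r_neq0 u0.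
  apply: hasder_eq; first by rewrite /F /gabs; derive.
  rewrite /= /f /gcos /gsin !gabsS//.
  have -> : expR ((sg + 1 - 1) * ln u - r * u) = u * gabs sg r u by rewrite -gabsS.
  by field; rewrite ?u1.
have := FTC_0y f F _ _ cf dF F0 Fy fi.
rewrite fE -!/(Gcos _ _ _ _) -!/(Gsin _ _ _ _) {fi fE}.
by move: (Gcos _ _ _ _) (Gcos _ _ _ _) (Gsin _ _ _ _) (Gsin _ _ _ _) => A B C E; clear; lra.
Qed.

Section Rotation.
Variables (sg tau : R).
Hypothesis sg0 : 0 < sg.

(* [(trig, dtrig)] is [(cos, - sin)] or [(sin, cos)], for the real and the
   imaginary part of the integral along the path [rr + i ss]. *)
Lemma Gamma_derive (rr ss drr dss : R -> R) (trig dtrig : R -> R) (a rho m : R) :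
  0 < rho -> (forall z, `|dtrig z| <= 1) -> (forall z, `|trig z| <= 1) ->
  (forall z, hasder trig z (dtrig z)) -> (forall z, {for z, continuous dtrig}) ->
  (forall t, hasder rr t (drr t)) -> (forall t, hasder ss t (dss t)) ->
  (forall t, a - 1 < t < a + 1 -> [/\ rho <= rr t, `|drr t| <= m & `|dss t| <= m]) ->
  let G t := \int[mu]_(u in `]0, +oo[) (gabs sg (rr t) u * trig (tau * ln u - ss t * u)) in
  hasder G a (- drr a * \int[mu]_(u in `]0, +oo[) (gabs (sg + 1) (rr a) u * trig (tau * ln u - ss a * u))
            - dss a * \int[mu]_(u in `]0, +oo[) (gabs (sg + 1) (rr a) u * dtrig (tau * ln u - ss a * u))).
Proof.
move=> rho0 dtrig1 trig1 dtrigP cdtrig drrP dssP pathP G.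
have sg10 : 0 < sg + 1 by exact: addr_gt0.
have ctrig z : {for z, continuous trig} by exact: hasder_continuous (dtrigP z).
pose f t u := gabs sg (rr t) u * trig (tau * ln u - ss t * u).
have cont (s' r' tt ss' : R) (tr : R -> R) (u : R) : (forall z, {for z, continuous tr}) -> 0 < u ->
    {for u, continuous (fun u => gabs s' r' u * tr (tt * ln u - ss' * u))}.
  move=> ctr u0; apply: (@continuousM _ _ (gabs s' r')); first exact: gabs_continuous.
  apply: (@continuous_comp _ _ _ (fun u => tt * ln u - ss' * u)); last exact: ctr.
  by apply: hasder_continuous; derive.
have integ s' r' ss' tr : 0 < s' -> 0 < r' -> (forall z, {for z, continuous tr}) -> (forall z, `|tr z| <= 1) ->
    mu.-integrable `]0, +oo[ (EFin \o (fun u => gabs s' r' u * tr (tau * ln u - ss' * u))).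
  move=> s0 r0 ctr tr1.
  apply: (dominated_integrable_pos _ _ (fun u => cont s' r' tau ss' tr u ctr) (gabs_integrable _ _ s0 r0)).
  by move=> u _; rewrite normrM (ger0_norm (gabs_ge0 _ _ _)) ler_piMr ?gabs_ge0.
have df t u : 0 < u -> hasder (f ^~ u) t (- drr t * (gabs (sg + 1) (rr t) u * trig (tau * ln u - ss t * u))
     - dss t * (gabs (sg + 1) (rr t) u * dtrig (tau * ln u - ss t * u))).
  move=> u0; rewrite /f /gabs; apply: hasder_eq.
    apply: hasder_mul.
      apply: hasder_expR; apply: hasder_add; first by derive.
      by apply: hasder_opp; apply: hasder_mul; [exact: drrP|derive].
    apply: hasder_comp; first exact: dtrigP.
    apply: hasder_add; first by derive.
    by apply: hasder_opp; apply: hasder_mul; [exact: dssP|derive].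
  have -> : expR ((sg + 1 - 1) * ln u - rr t * u) = u * gabs sg (rr t) u by rewrite -gabsS.
  by rewrite /= /gabs; ring.
have m0 t : a - 1 < t < a + 1 -> 0 <= m.
  by move=> /pathP[_ h _]; apply: le_trans h.
have aI : a - 1 < a < a + 1 by rewrite ltrBlDr ltrDl ltr01.
have rr0 t : a - 1 < t < a + 1 -> 0 < rr t by move=> /pathP[h _ _]; exact: lt_le_trans h.
have h1 : forall t, `]a - 1, a + 1[%classic t -> mu.-integrable `]0, +oo[ (EFin \o f t).
  by move=> t /=; rewrite in_itv/= => /rr0 r0; exact: integ.
have h2 : forall t u, `]a - 1, a + 1[%classic t -> `]0, +oo[%classic u -> derivable (f ^~ u) t 1.
  by move=> t u _ /=; rewrite in_itv/= andbT => u0; have [] := df t u u0.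
pose D u := 2 * m * gabs (sg + 1) rho u.
have h3 u : 0 <= D u by rewrite mulr_ge0 ?gabs_ge0// mulr_ge0// (m0 a).
have h4 : mu.-integrable `]0, +oo[ (EFin \o D).
  by apply: eq_integrable (integrableZl _ (2 * m) (gabs_integrable _ _ sg10 rho0)) => //.
have h5 : forall t u, `]a - 1, a + 1[%classic t -> `]0, +oo[%classic u ->
    `|partial1of2 f t u| <= D u.
  move=> t u /=; rewrite !in_itv/= andbT => tI u0; have [rt dt st] := pathP t tI.
  rewrite /partial1of2 (hasder_derive1 _ _ _ (df t u u0)).
  have gle : gabs (sg + 1) (rr t) u <= gabs (sg + 1) rho u.
    by rewrite ler_expR lerD2l lerN2 ler_wpM2r// ltW.
  have le1 (k z : R) : `|k| <= m -> `|z| <= 1 -> `|k * (gabs (sg + 1) (rr t) u * z)| <= m * gabs (sg + 1) rho u.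
    move=> km z1; rewrite normrM ler_pM// normrM (ger0_norm (gabs_ge0 _ _ _)).
    by rewrite -[leRHS]mulr1 ler_pM ?gabs_ge0.
  apply: le_trans (ler_normB _ _) _; rewrite mulNr normrN.
  apply: le_trans (lerD (le1 _ _ dt (trig1 _)) (le1 _ _ st (dtrig1 _))) _.
  by rewrite /D; lra.
have aI' : `]a - 1, a + 1[%classic a by rewrite /= in_itv.
split.
  by apply: (derivable_under_integral _ aI' h1 h2 h3 h4 h5).
rewrite -derive1E (differentiation_under_integral _ aI' h1 h2 h3 h4 h5)//.
have i1 := integ _ _ (ss a) trig sg10 (rr0 _ aI) ctrig trig1.
have i2 := integ _ _ (ss a) dtrig sg10 (rr0 _ aI) cdtrig dtrig1.
have [_ E] := integral_lin4 _ _ _ _ (- drr a) (- dss a) 0 0 i1 i2 i1 i2.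
move: E; rewrite !mul0r !addr0 => E.
rewrite -[- (dss a * _)]mulNr -E; apply: eq_Rintegral => u.
rewrite inE/= in_itv/= andbT => u0.
rewrite /partial1of2 (hasder_derive1 _ _ _ (df a u u0)); ring.
Qed.

Section PathFrom1.
Variables (w1 w2 : R).
Hypothesis w10 : 0 < w1.

(* The path [w1 `^ t + i t w2] joins [1] to [w1 + i w2] and stays in the right
   half-plane for every real [t]. *)
Let rr t : R := expR (t * ln w1).
Let ss t : R := t * w2.

Let drr t : hasder rr t (ln w1 * rr t).
Proof. by apply: hasder_eq; [rewrite /rr; derive|rewrite /rr/=; ring]. Qed.

Let dss t : hasder ss t w2.
Proof. by apply: hasder_eq; [rewrite /ss; derive|rewrite /=; ring]. Qed.

Let rr0 t : 0 < rr t. Proof. exact: expR_gt0. Qed.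

Let path_bounds a t : a - 1 < t < a + 1 ->
  [/\ expR (- ((`|a| + 1) * `|ln w1|)) <= rr t,
     `|ln w1 * rr t| <= `|ln w1| * expR ((`|a| + 1) * `|ln w1|) + `|w2| &
     `|w2| <= `|ln w1| * expR ((`|a| + 1) * `|ln w1|) + `|w2|].
Proof.
move=> /andP[t1 t2].
have ta : `|t * ln w1| <= (`|a| + 1) * `|ln w1|.
  rewrite normrM ler_wpM2r//; have := ler_norm a; have := ler_norm (- a).
  by rewrite normrN ler_norml => h1 h2; apply/andP; split; lra.
move: ta; rewrite ler_norml => /andP[ta1 ta2]; split.
- by rewrite ler_expR.
- rewrite normrM (gtr0_norm (rr0 t)) (@le_trans _ _ (`|ln w1| * expR ((`|a| + 1) * `|ln w1|)))//.
    by rewrite ler_wpM2l// ler_expR.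
  by rewrite lerDl.
- by rewrite lerDr mulr_ge0// expR_ge0.
Qed.

Let X t := Gcos sg tau (rr t) (ss t).
Let Y t := Gsin sg tau (rr t) (ss t).
Let X1 t := Gcos (sg + 1) tau (rr t) (ss t).
Let Y1 t := Gsin (sg + 1) tau (rr t) (ss t).

Let dX t : hasder X t (- (ln w1 * rr t) * X1 t + w2 * Y1 t).
Proof.
have := @Gamma_derive rr ss (fun t => ln w1 * rr t) (fun=> w2) cos (fun z => - sin z) t _ _
  (expR_gt0 _) _ (@cos_max R) _ _ drr dss (path_bounds t).
rewrite /=; set Z := (X in _ -> _ -> _ -> hasder _ _ (_ - _ * X)) => h.
have -> : w2 * Y1 t = - (w2 * Z).
  rewrite -mulrN; congr (_ * _); rewrite /Z /Y1 /Gsin.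
  under [in RHS]eq_Rintegral do rewrite mulrN -mulN1r.
  rewrite RintegralZl// ?mulN1r ?opprK//.
  by apply: gsin_integrable; rewrite ?addr_gt0.
apply: h => z.
- by rewrite normrN sin_max.
- exact: is_derive_cos.
- by apply: hasder_continuous; derive.
Qed.

Let dY t : hasder Y t (- (ln w1 * rr t) * Y1 t - w2 * X1 t).
Proof.
apply: (@Gamma_derive rr ss (fun t => ln w1 * rr t) (fun=> w2) sin cos t _ _
  (expR_gt0 _) (@cos_max R) (@sin_max R) _ _ drr dss (path_bounds t)) => z.
- exact: is_derive_sin.
- exact: continuous_cos.
Qed.

(** L + i A is the principal logarithm of the path point w = rr + i ss, and al + i be is p log w, so
    that exp(al + i be) = w^p. *)
Let L t := ln (rr t ^+ 2 + ss t ^+ 2) / 2.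
Let A t := atan (ss t / rr t).
Let al t := sg * L t - tau * A t.
Let be t := sg * A t + tau * L t.

Let n0 t : 0 < rr t ^+ 2 + ss t ^+ 2.
Proof. by rewrite ltr_pwDl ?sqr_ge0// exprn_gt0. Qed.

Let dL t : hasder L t ((ln w1 * rr t ^+ 2 + w2 * ss t) / (rr t ^+ 2 + ss t ^+ 2)).
Proof.
have n1 := lt0r_neq0 (n0 t).
apply: hasder_eq.
  apply: hasder_mul; last exact: hasder_cst.
  apply: hasder_ln; first exact: n0.
  by apply: hasder_add; apply: hasder_exp; [exact: drr|exact: dss].
by rewrite /=; field; rewrite ?n1.
Qed.

Let dA t : hasder A t ((w2 * rr t - ss t * (ln w1 * rr t)) / (rr t ^+ 2 + ss t ^+ 2)).
Proof.
have n1 := lt0r_neq0 (n0 t); have r1 := lt0r_neq0 (rr0 t).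
apply: hasder_eq.
  apply: hasder_atan; apply: hasder_mul; first exact: dss.
  by apply: hasder_inv; [exact: r1|exact: drr].
rewrite /=.
have n2 : 1 + (ss t / rr t) ^+ 2 = (rr t ^+ 2 + ss t ^+ 2) / rr t ^+ 2 by field.
by rewrite n2 invf_div; field; rewrite ?n1 ?r1.
Qed.

Let E t := expR (al t).

(** With [solve2], integration by parts solved for I(p+1) = p I(p) / w. The derivative -w' I(p+1) of
    the integral becomes -p (w' / w) I(p), which cancels the derivative of w^p. *)
Let solve1 t : X1 t = (rr t * (sg * X t - tau * Y t) + ss t * (tau * X t + sg * Y t)) / (rr t ^+ 2 + ss t ^+ 2).
Proof.
have n1 := lt0r_neq0 (n0 t).
rewrite /X /Y Gamma_by_parts_cos// Gamma_by_parts_sin// -/(X1 t) -/(Y1 t).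
by field; rewrite ?n1.
Qed.

Let solve2 t : Y1 t = (rr t * (tau * X t + sg * Y t) - ss t * (sg * X t - tau * Y t)) / (rr t ^+ 2 + ss t ^+ 2).
Proof.
have n1 := lt0r_neq0 (n0 t).
rewrite /X /Y Gamma_by_parts_cos// Gamma_by_parts_sin// -/(X1 t) -/(Y1 t).
by field; rewrite ?n1.
Qed.

Let dP t : hasder (fun t => E t * (X t * cos (be t) - Y t * sin (be t))) t 0.
Proof.
have n1 := lt0r_neq0 (n0 t).
apply: hasder_eq.
  apply: hasder_mul.
    apply: hasder_expR; apply: hasder_add; first by apply: hasder_mul; [exact: hasder_cst|exact: dL].
    by apply: hasder_opp; apply: hasder_mul; [exact: hasder_cst|exact: dA].
  apply: hasder_add.
    apply: hasder_mul; first exact: dX.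
    by apply: hasder_cos; apply: hasder_add; (apply: hasder_mul; [exact: hasder_cst|first [exact: dL|exact: dA]]).
  apply: hasder_opp; apply: hasder_mul; first exact: dY.
  by apply: hasder_sin; apply: hasder_add; (apply: hasder_mul; [exact: hasder_cst|first [exact: dL|exact: dA]]).
rewrite /= -/(al t) -/(E t) solve1 solve2.
by field; rewrite ?n1.
Qed.

Let dQ t : hasder (fun t => E t * (X t * sin (be t) + Y t * cos (be t))) t 0.
Proof.
have n1 := lt0r_neq0 (n0 t).
apply: hasder_eq.
  apply: hasder_mul.
    apply: hasder_expR; apply: hasder_add; first by apply: hasder_mul; [exact: hasder_cst|exact: dL].
    by apply: hasder_opp; apply: hasder_mul; [exact: hasder_cst|exact: dA].
  apply: hasder_add.
    apply: hasder_mul; first exact: dX.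
    by apply: hasder_sin; apply: hasder_add; (apply: hasder_mul; [exact: hasder_cst|first [exact: dL|exact: dA]]).
  apply: hasder_mul; first exact: dY.
  by apply: hasder_cos; apply: hasder_add; (apply: hasder_mul; [exact: hasder_cst|first [exact: dL|exact: dA]]).
rewrite /= -/(al t) -/(E t) solve1 solve2.
by field; rewrite ?n1.
Qed.

Let rr1 : rr 1 = w1. Proof. by rewrite /rr mul1r (lnK w10). Qed.
Let ss1 : ss 1 = w2. Proof. by rewrite /ss mul1r. Qed.
Let rr00 : rr 0 = 1. Proof. by rewrite /rr mul0r expR0. Qed.
Let ss0 : ss 0 = 0. Proof. by rewrite /ss mul0r. Qed.

(* [Gamma(p) = w ^ p * \int u ^ (p - 1) * exp (- w u) du], in components. *)
Lemma Gamma_rotation (l := ln (w1 ^+ 2 + w2 ^+ 2) / 2) (th := atan (w2 / w1)) :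
  Gcos sg tau 1 0 = expR (sg * l - tau * th) *
    (Gcos sg tau w1 w2 * cos (sg * th + tau * l) - Gsin sg tau w1 w2 * sin (sg * th + tau * l)) /\
  Gsin sg tau 1 0 = expR (sg * l - tau * th) *
    (Gcos sg tau w1 w2 * sin (sg * th + tau * l) + Gsin sg tau w1 w2 * cos (sg * th + tau * l)).
Proof.
have cP := @is_derive_0_is_cst R _ 1 0 dP.
have cQ := @is_derive_0_is_cst R _ 1 0 dQ.
have L0 : L 0 = 0 by rewrite /L rr00 ss0 expr1n expr0n addr0 ln1 mul0r.
have A0 : A 0 = 0 by rewrite /A ss0 mul0r atan0.
have E0 : E 0 = 1 by rewrite /E /al L0 A0 !mulr0 subrr expR0.
have b0 : be 0 = 0 by rewrite /be L0 A0 !mulr0 addr0.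
have L1 : L 1 = l by rewrite /L rr1 ss1.
have A1 : A 1 = th by rewrite /A rr1 ss1.
move: cP cQ; rewrite /= E0 b0 cos0 sin0 /E /al /be L1 A1 /X /Y rr1 ss1 rr00 ss0.
by rewrite !mul1r !mulr1 !mulr0 subr0 add0r => -> ->.
Qed.

End PathFrom1.
End Rotation.
End GammaIdentities.

(** * Gamma has no zero in the right half-plane *)

Section GammaNonvanishing.
Context {R : realType}.
Notation mu := (@lebesgue_measure R).
Implicit Types (sg tau : R).

Lemma cos_ge_quadratic (z : R) : 1 - z ^+ 2 / 2 <= cos z.
Proof.
have -> : cos z = 1 - 2 * sin (z / 2) ^+ 2.
  have {1}-> : z = (z / 2) *+ 2 by rewrite -mulr_natr divfK.
  by rewrite cos_mulr2n cos2sin2 -mulr_natr; ring.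
have h : `|sin (z / 2)| <= `|z / 2|.
  case: (lerP 0 (z / 2)) => z0; first by rewrite (ger0_norm z0) sin_le_id.
  rewrite (ltr0_norm z0) -normrN -sinN.
  by rewrite sin_le_id// oppr_ge0 ltW.
have : sin (z / 2) ^+ 2 <= (z / 2) ^+ 2.
  by rewrite -(real_normK (num_real (sin _))) -(real_normK (num_real (z / 2))) lerXn2r ?nnegrE.
by rewrite expr_div_n; lra.
Qed.

(** The right-hand side is (exp(l/2) - exp(-l/2))^2, and exp(t) - exp(-t) >= 2 t for t >= 0 because
    its derivative is at least 2. *)
Lemma sqr_le_cosh (l : R) : l ^+ 2 <= expR l - 2 + expR (- l).
Proof.
wlog l0 : l / 0 <= l.
  move=> h; case: (lerP 0 l) => [/h//|l0].
  by have := h (- l); rewrite oppr_ge0 sqrrN opprK (ltW l0) => /(_ isT); lra.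
have h : `|2 * (l / 2) - 2 * 0| <= (expR (l / 2) - expR (- (l / 2))) - (expR 0 - expR (- 0)).
  apply: (@hasder_dist_le R (fun t => 2 * t) (fun t => expR t - expR (- t)) (fun=> 2)
    (fun t => expR t + expR (- t))); first by rewrite divr_ge0.
  - by move=> t _; apply: hasder_eq; [derive|rewrite /=; ring].
  - by move=> t _; apply: hasder_eq; [derive|rewrite /=; ring].
  - by move=> t _; rewrite normr_nat; have := expR_ge1Dx t; have := expR_ge1Dx (- t); lra.
move: h; rewrite mulr0 subr0 oppr0 subrr subr0 mulrCA divff// mulr1 ger0_norm// => h.
have -> : expR l - 2 + expR (- l) = (expR (l / 2) - expR (- (l / 2))) ^+ 2.
  have e1 : expR l = expR (l / 2) ^+ 2 by rewrite -expRM_natr divfK.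
  have e2 : expR (- l) = expR (- (l / 2)) ^+ 2 by rewrite -expRM_natr mulNr divfK.
  have e3 : expR (l / 2) * expR (- (l / 2)) = 1 by rewrite -expRD subrr expR0.
  by rewrite e1 e2; lra.
by rewrite lerXn2r// nnegrE (le_trans l0).
Qed.

Let G0E m : Gcos m 0 1 0 = \int[mu]_(u in `]0, +oo[) gabs m 1 u.
Proof. by apply: eq_Rintegral => u _; rewrite /gcos !mul0r subrr cos0 mulr1. Qed.

Lemma real_GammaS m : 0 < m -> Gcos (m + 1) 0 1 0 = m * Gcos m 0 1 0 :> R.
Proof.
by move=> m0; have := Gamma_by_parts_cos m 0 1 0 m0 ltr01; rewrite mul0r subr0 mul1r mul0r subr0 => <-.
Qed.

(** For m >= 1 the integrand is at least exp(-2) on [1, 2]. *)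
Lemma real_Gamma_gt0 m : 1 <= m -> 0 < Gcos m 0 1 0 :> R.
Proof.
move=> m1; have m0 : 0 < m by exact: lt_le_trans m1.
rewrite G0E; have ig := gabs_integrable _ _ m0 (@ltr01 R).
apply: (@lt_le_trans _ _ (expR (- 2))); first exact: expR_gt0.
rewrite -lee_fin /Rintegral fineK; last exact: integrable_fin_num.
apply: (@le_trans _ _ (\int[mu]_(u in `[1%R, 2%R]) (gabs m 1 u)%:E)%E); last first.
  apply: ge0_subset_integral => //.
  - by have [] := integrableP _ _ _ ig.
  - by move=> u _; rewrite lee_fin gabs_ge0.
  - by move=> u /=; rewrite !in_itv/= andbT => /andP[/(lt_le_trans ltr01)].
apply: (@le_trans _ _ (\int[mu]_(u in `[1%R, 2%R]) (expR (- 2))%:E)%E).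
  rewrite integral_cst//= lebesgue_measure_itv/= lte_fin ltr1n/= -EFinB -EFinM lee_fin.
  by rewrite (_ : 2 - 1 = 1 :> R) ?mulr1//; lra.
apply: ge0_le_integral => //.
- apply/measurable_EFinP; apply: measurable_funS (continuous_measurable_pos _ (gabs_continuous m 1)) => //.
  by move=> u /=; rewrite !in_itv/= andbT => /andP[/(lt_le_trans ltr01)].
- move=> u /=; rewrite in_itv/= => /andP[u1 u2]; rewrite lee_fin ler_expR mul1r.
  have : 0 <= (m - 1) * ln u by rewrite mulr_ge0 ?subr_ge0// ln_ge0.
  lra.
Qed.

(* A zero at [p = sg + i tau] propagates to [m + i tau], [m = sg + n].  For large
   [m] the weight [u `^ (m - 1) * exp (- u)] concentrates at [v = u / m = 1], and
   [cos (tau ln v) >= 1 - tau ^ 2 / 2 * (v - 2 + 1 / v)] bounds the real part of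
   [m ^ (- i tau) * Gamma(m + i tau)] from below by a positive number. *)
Lemma Gamma_neq0 sg tau : 0 < sg -> ~ (Gcos sg tau 1 0 = 0 /\ Gsin sg tau 1 0 = 0).
Proof.
move=> sg0 G0.
(* So large that m = sg + n satisfies both m - 1 > tau^2 / 2 and m - 1 >= 1. *)
have [n hn] : exists n : nat, 2 + tau ^+ 2 / 2 < n%:R.
  by exists (Num.bound (2 + tau ^+ 2 / 2)); apply: archi_boundP; rewrite addr_ge0// divr_ge0 ?sqr_ge0.
set m := sg + n%:R.
have tau20 : 0 <= tau ^+ 2 by exact: sqr_ge0.
have m1 : tau ^+ 2 / 2 < m - 1 by rewrite /m; lra.
have m10 : 0 < m - 1 by lra.
have m11 : 1 <= m - 1 by rewrite /m; lra.
have m0 : 0 < m by lra.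
have mm0 : 0 < m + 1 by lra.
have Gn k : Gcos (sg + k%:R) tau 1 0 = 0 /\ Gsin (sg + k%:R) tau 1 0 = 0.
  elim: k => [|k [IH1 IH2]]; first by rewrite addr0.
  have sn0 : 0 < sg + k%:R by rewrite ltr_pwDl.
  have := Gamma_by_parts_cos _ tau 1 0 sn0 ltr01.
  have := Gamma_by_parts_sin _ tau 1 0 sn0 ltr01.
  rewrite IH1 IH2 -addrA natr1 !mulr0 mul0r mul1r addr0 add0r => <-.
  by rewrite mul1r subr0 mul0r subr0 => <-.
have [{}G1 {}G2] := Gn n; rewrite -/m in G1 G2.
have i0 := gabs_integrable _ _ m0 (@ltr01 R).
have i1 := gabs_integrable _ _ mm0 (@ltr01 R).
have i2 := gabs_integrable _ _ m10 (@ltr01 R).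
have ic := gcos_integrable _ tau _ 0 m0 (@ltr01 R).
have is_ := gsin_integrable _ tau _ 0 m0 (@ltr01 R).
have [j1 E1] := integral_lin4 _ _ _ _ (cos (tau * ln m)) (sin (tau * ln m)) 0 0 ic is_ ic is_.
have [j2 E2] := integral_lin4 _ _ _ _ (1 + tau ^+ 2) (- (tau ^+ 2 / (2 * m))) (- (tau ^+ 2 / 2 * m)) 0 i0 i1 i2 i2.
have := le_Rintegral _ j2 j1; rewrite E1 E2 => h.
have {h} := h (measurable_itv _) _; rewrite -!/(Gcos _ _ _ _) -!/(Gsin _ _ _ _) G1 G2 -!G0E.
rewrite real_GammaS// -[in Gcos m 0 1 0](subrK 1 m) real_GammaS// => h.
have Gp := real_Gamma_gt0 _ m11.
(* The lower bound integrates to multiples of Gamma(m), Gamma(m+1) and Gamma(m-1); the functional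
   equation reduces all three to Gamma(m-1), and the coefficients add up to m - 1 - tau^2 / 2 >
   0. *)
have {}h : (m - 1 - tau ^+ 2 / 2) * Gcos (m - 1) 0 1 0 <= 0.
  have -> : (m - 1 - tau ^+ 2 / 2) * Gcos (m - 1) 0 1 0 =
    (1 + tau ^+ 2) * ((m - 1) * Gcos (m - 1) 0 1 0) +
    - (tau ^+ 2 / (2 * m)) * (m * ((m - 1) * Gcos (m - 1) 0 1 0)) +
    (- (tau ^+ 2 / 2 * m) * Gcos (m - 1) 0 1 0 + 0 * Gcos (m - 1) 0 1 0).
    by field; rewrite ?(lt0r_neq0 m0).
  rewrite (le_trans (h _)) ?(mulr0, mul0r, addr0)// => {h} u /=.
  rewrite in_itv/= andbT => u0; rewrite !mul0r !addr0.
  set l := ln u - ln m.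
  have el : expR l = u / m by rewrite expRB (lnK u0) (lnK m0).
  have eNl : expR (- l) = m / u by rewrite expRN el invf_div.
  have -> : cos (tau * ln m) * gcos m tau 1 0 u + sin (tau * ln m) * gsin m tau 1 0 u =
      gabs m 1 u * cos (tau * l).
    by rewrite /gcos /gsin mul0r subr0 /l mulrBr cosB; ring.
  have g2 : gabs (m - 1) 1 u = gabs m 1 u / u.
    by rewrite -{2}[m](subrK 1) gabsS// mulrAC divff ?mul1r// lt0r_neq0.
  rewrite gabsS// g2.
  have -> : (1 + tau ^+ 2) * gabs m 1 u + - (tau ^+ 2 / (2 * m)) * (u * gabs m 1 u) +
      - (tau ^+ 2 / 2 * m) * (gabs m 1 u / u) =
      gabs m 1 u * (1 - tau ^+ 2 / 2 * (u / m - 2 + m / u)).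
    by field; rewrite ?(lt0r_neq0 m0) ?(lt0r_neq0 u0).
  rewrite ler_wpM2l ?gabs_ge0// (le_trans _ (cos_ge_quadratic _))//.
  rewrite lerD2l lerN2 exprMn mulrAC ler_wpM2l ?divr_ge0//.
  by rewrite -el -eNl sqr_le_cosh.
by move: h; rewrite leNgt mulr_gt0// subr_gt0.
Qed.

End GammaNonvanishing.

(** * Fubini *)

Section Fubini.
Context {R : realType}.
Notation mu := (@lebesgue_measure R).

Lemma cosh_gt0 (x : R) : 0 < cosh x.
Proof. by rewrite divr_gt0// addr_gt0 ?expR_gt0. Qed.

(** To be used with [w0] y or 1 / y, [phi] the matching multiple of eta^3, [k] the real or imaginary
    part of x^(2p-1) exp(-a x^2 / pi), and b = 2 Re p. *)
Variables (phi w0 k : R -> R) (b : R).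
Hypotheses (b0 : 0 < b)
  (mphi : measurable_fun (`]0, +oo[ : set R) phi)
  (mw0 : measurable_fun (`]0, +oo[ : set R) w0)
  (phi0 : forall y : R, 0 < y -> 0 <= phi y)
  (w00 : forall y : R, 0 < y -> 0 < w0 y)
  (phiE : forall x : R, 0 < x ->
    (\int[mu]_(y in `]0%R, +oo[) (phi y * expR (- (x ^+ 2 / pi * w0 y)))%:E = ((cosh x)^-1)%:E)%E)
  (ck : forall u : R, 0 < u -> {for u, continuous k})
  (kle : forall u : R, 0 < u -> `|k u| <= expR ((b - 1) * ln u)).

Let D : set R := `]0, +oo[%classic.

Let mD : measurable D. Proof. exact: measurable_itv. Qed.

Let inD (x : R) : D x = (0 < x) :> Prop. Proof. by rewrite /D/= in_itv/= andbT. Qed.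

Lemma integrable_kernel_cosh : mu.-integrable `]0, +oo[ (EFin \o (fun x => k x / cosh x)).
Proof.
have ig : mu.-integrable `]0, +oo[ (EFin \o (fun x => 2 * gabs b 1 x)).
  by apply: eq_integrable (integrableZl _ 2 (gabs_integrable _ _ b0 (@ltr01 R))) => //.
apply: (dominated_integrable_pos _ _ _ ig) => x x0.
  apply: (@continuousM _ _ k (fun x => (cosh x)^-1)); first exact: ck.
  have h : cosh x != 0 by rewrite lt0r_neq0// cosh_gt0.
  by apply: hasder_continuous; apply: hasder_inv; [exact: h|rewrite /cosh; derive].
rewrite normrM normfV (gtr0_norm (cosh_gt0 x)) /gabs mul1r expRD mulrCA.
apply: ler_pM; rewrite ?invr_ge0 ?(ltW (cosh_gt0 x)) ?kle//.
rewrite /cosh invf_div expRN ler_wpM2l// lef_pV2 ?posrE ?addr_gt0 ?invr_gt0 ?expR_gt0//.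
by rewrite lerDl invr_ge0 expR_ge0.
Qed.

Lemma integrable_kernel_exp (v : R) : 0 < v ->
  mu.-integrable `]0, +oo[ (EFin \o (fun x => k x * expR (- (x ^+ 2 / pi * v)))).
Proof.
(* Completing the square gives x <= x^2 v / pi + pi / (4 v), so exp(-x^2 v / pi) <= c exp(-x). *)
move=> v0; pose c := expR (pi / (4 * v)).
have ig : mu.-integrable `]0, +oo[ (EFin \o (fun x => c * gabs b 1 x)).
  by apply: eq_integrable (integrableZl _ c (gabs_integrable _ _ b0 (@ltr01 R))) => //.
apply: (dominated_integrable_pos _ _ _ ig) => x x0.
  apply: (@continuousM _ _ k (fun x => expR (- (x ^+ 2 / pi * v)))); first exact: ck.
  by apply: hasder_continuous; derive.
rewrite normrM (gtr0_norm (expR_gt0 _)) /gabs mul1r expRD mulrCA.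
apply: ler_pM; rewrite ?expR_ge0 ?kle// -expRD ler_expR -subr_ge0.
have p0 : 0 < (pi : R) by exact: pi_gt0.
have -> : pi / (4 * v) - x - - (x ^+ 2 / pi * v) = v / pi * (x - pi / (2 * v)) ^+ 2.
  by move: (pi) p0 => P p0; field; rewrite ?(lt0r_neq0 p0) ?(lt0r_neq0 v0).
by rewrite mulr_ge0 ?sqr_ge0// divr_ge0// ltW.
Qed.

Let patch_in (g : R -> R) x : 0 < x -> (g \_ D) x = g x.
Proof. by move=> x0; rewrite patchE mem_set// inD. Qed.

Let patch_out (g : R -> R) x : ~ 0 < x -> (g \_ D) x = 0.
Proof. by move=> x0; rewrite patchE memNset// inD. Qed.

(** The pair is (y, x), extended by zero to the whole plane, where Fubini's theorem is applied. The
    kernel is a parameter because |k| is inserted too, to integrate the absolute value. *)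
Let f (h : R -> R) (z : R * R) : R :=
  ((h \_ D) z.2 * (phi \_ D) z.1) * expR (- (z.2 ^+ 2 / pi * (w0 \_ D) z.1)).

Let mf : measurable_fun setT (EFin \o f k).
Proof.
have mk : measurable_fun D k by exact: continuous_measurable_pos.
have mr g : measurable_fun D g -> measurable_fun setT (g \_ D : R -> R).
  by move=> mg; apply/(measurable_restrictT g mD).
apply/measurable_EFinP; apply: measurable_funM.
  apply: measurable_funM.
    by apply: (measurableT_comp (mr _ mk)); exact: measurable_snd.
  by apply: (measurableT_comp (mr _ mphi)); exact: measurable_fst.
apply: (measurableT_comp (@measurable_expR R)).
apply: measurable_funN; apply: measurable_funM.
  apply: measurable_funM => //.
  apply: measurable_funX; exact: measurable_snd.
by apply: (measurableT_comp (mr _ mw0)); exact: measurable_fst.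
Qed.

Let f_in h x y : 0 < x -> 0 < y -> f h (y, x) = h x * (phi y * expR (- (x ^+ 2 / pi * w0 y))).
Proof. by move=> x0 y0; rewrite /f /= !patch_in// mulrA. Qed.

Let f_x h x y : ~ 0 < x -> f h (y, x) = 0.
Proof. by move=> x0; rewrite /f /= (patch_out h) ?mul0r. Qed.

Let f_y h x y : ~ 0 < y -> f h (y, x) = 0.
Proof. by move=> y0; rewrite /f /= (patch_out phi) ?mulr0 ?mul0r. Qed.

Let integrable_phi x : 0 < x ->
  mu.-integrable `]0, +oo[ (fun y => (phi y * expR (- (x ^+ 2 / pi * w0 y)))%:E).
Proof.
move=> x0; apply/integrableP; split.
  apply/measurable_EFinP/measurable_funM => //.
  apply: (measurableT_comp (@measurable_expR R)); apply: measurable_funN.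
  by apply: measurable_funM => //; exact: measurable_cst.
rewrite (_ : (\int[mu]_(y in _) _)%E = ((cosh x)^-1)%:E) ?ltry// -phiE//.
apply: eq_integral => y /set_mem yD; have y0 : 0 < y by rewrite -inD.
by rewrite gee0_abs// lee_fin mulr_ge0 ?expR_ge0 ?phi0.
Qed.

Let inner1 h x : (\int[mu]_y (f h (y, x))%:E = (((fun x => h x / cosh x) \_ D) x)%:E)%E.
Proof.
have [x0|/negP x0] := boolP (0 < x); last first.
  by rewrite patch_out//; apply: integral0_eq => y _; rewrite f_x.
rewrite patch_in// EFinM -phiE// -integralZl//; last exact: integrable_phi.
rewrite [RHS]integral_mkcond; apply: eq_integral => y _ /=; rewrite patchE.
have [y0|/negP y0] := boolP (0 < y); last by rewrite f_y// memNset//= in_itv/= andbT.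
by rewrite f_in// mem_set//= in_itv/= andbT.
Qed.

Let inner2 y : (\int[mu]_x (f k (y, x))%:E = (((fun y => phi y *
    \int[mu]_(x in `]0, +oo[) (k x * expR (- (x ^+ 2 / pi * w0 y)))%R) \_ D) y)%:E)%E.
Proof.
have [y0|/negP y0] := boolP (0 < y); last first.
  by rewrite patch_out//; apply: integral0_eq => x _; rewrite f_y.
have ik := integrable_kernel_exp _ (w00 _ y0).
rewrite patch_in// EFinM /Rintegral fineK; last exact: integrable_fin_num.
rewrite -integralZl// [RHS]integral_mkcond; apply: eq_integral => x _ /=; rewrite patchE.
have [x0|/negP x0] := boolP (0 < x); last by rewrite f_x// memNset//= in_itv/= andbT.
by rewrite f_in// mem_set/= ?in_itv/= ?andbT// -EFinM; congr EFin; ring.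
Qed.

(** As phi >= 0, the inner integral of the absolute value over y is exactly |k x| / cosh x, which
    [integrable_kernel_cosh] makes integrable. *)
Let intf : (mu \x mu)%E.-integrable setT (EFin \o f k).
Proof.
apply: (@integrable21ltyP _ _ _ _ R mu mu (EFin \o f k) mf).2.
have fE x y : (`|(EFin \o f k) (y, x)| = (f (fun x => `|k x|) (y, x))%:E)%E.
  rewrite /=; congr EFin.
  have [x0|/negP x0] := boolP (0 < x); last by rewrite !f_x// normr0.
  have [y0|/negP y0] := boolP (0 < y); last by rewrite !f_y// normr0.
  by rewrite !f_in// normrM; congr (_ * _); rewrite ger0_norm// mulr_ge0 ?expR_ge0 ?phi0.
under eq_integral do (under eq_integral do rewrite fE; rewrite inner1).
have [_ h] := integrableP _ _ _ integrable_kernel_cosh; rewrite integral_mkcond in h.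
apply: le_lt_trans h; rewrite le_eqVlt; apply/orP; left; apply/eqP.
apply: eq_integral => x _; rewrite !patchE.
by case: ifPn => // xD /=; rewrite normrM normfV (gtr0_norm (cosh_gt0 x)).
Qed.

Lemma fubini_kernel :
  mu.-integrable `]0, +oo[ (EFin \o (fun y => phi y *
    \int[mu]_(x in `]0, +oo[) (k x * expR (- (x ^+ 2 / pi * w0 y))))) /\
  \int[mu]_(y in `]0, +oo[) (phi y *
    \int[mu]_(x in `]0, +oo[) (k x * expR (- (x ^+ 2 / pi * w0 y)))) =
  \int[mu]_(x in `]0, +oo[) (k x / cosh x).
Proof.
split.
  have := integrable_fubini_F intf; rewrite /fubini_F => h.
  set F := EFin \o _; suff : mu.-integrable (setT `&` `]0, +oo[) F by rewrite setTI.
  apply/integrable_restrict => //; rewrite /F.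
  apply: eq_integrable h => // y _ /=; rewrite inner2 !patchE. by case: ifP.
rewrite Rintegral_mkcond [RHS]Rintegral_mkcond /Rintegral; congr fine.
have := Fubini intf; rewrite /=.
under eq_integral do rewrite inner2.
under [X in _ = X]eq_integral do rewrite inner1.
by move=> ->.
Qed.

End Fubini.

(** * Complex powers and integrals *)

Section ComplexPowers.
Context {R : realType}.
Implicit Types (x : R) (p w z : R[i]).

Lemma cexpD z w : cexp (z + w) = cexp z * cexp w.
Proof.
case: z w => [a b] [c d]; rewrite /cexp /= expRD cosD sinD.
by apply/eqP; rewrite eq_complex /=; apply/andP; split; apply/eqP; ring.
Qed.

Lemma cexp0 : cexp 0 = 1 :> R[i].
Proof. by rewrite /cexp /= expR0 cos0 sin0 mulr1 mulr0. Qed.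

Lemma cexp_neq0 z : cexp z != 0.
Proof.
apply/negP => /eqP z0; have := cexpD z (- z); rewrite z0 mul0r subrr cexp0.
by move/eqP; rewrite oner_eq0.
Qed.

Lemma cpow_neq0 z p : cpow z p != 0. Proof. exact: cexp_neq0. Qed.

Lemma cpowDr z p w : cpow z (p + w) = cpow z p * cpow z w.
Proof. by rewrite /cpow mulrDl cexpD. Qed.

Lemma clog_pos x : 0 < x -> clog x%:C = (ln x)%:C.
Proof.
move=> x0; have nx : Normc.normc x%:C = x.
  by rewrite /Normc.normc /= expr0n addr0 sqrtr_sqr gtr0_norm.
by rewrite /clog /carg nx /= lexx divff ?lt0r_neq0// acos1.
Qed.

(** Trades the case distinction of [carg] for an arctangent, smooth across the real axis; this is
    the form of the logarithm in [Gamma_rotation]. *)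
Lemma clog_Re_gt0 w : 0 < complex.Re w ->
  clog w = (ln (complex.Re w ^+ 2 + complex.Im w ^+ 2) / 2) +i* atan (complex.Im w / complex.Re w).
Proof.
case: w => [r s] /= r0; have r1 := lt0r_neq0 r0.
have n0 : 0 < r ^+ 2 + s ^+ 2 by rewrite ltr_pwDl ?sqr_ge0// exprn_gt0.
have nE : Normc.normc (r +i* s) = Num.sqrt (r ^+ 2 + s ^+ 2) by [].
have sn0 : 0 < Num.sqrt (r ^+ 2 + s ^+ 2) by rewrite sqrtr_gt0.
rewrite /clog nE; congr (_ +i* _).
  have {2}-> : r ^+ 2 + s ^+ 2 = Num.sqrt (r ^+ 2 + s ^+ 2) ^+ 2 by rewrite sqr_sqrtr// ltW.
  by rewrite lnXn//; field.
have cE : r / Num.sqrt (r ^+ 2 + s ^+ 2) = cos (atan (s / r)).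
  rewrite cos_atan.
  have -> : 1 + (s / r) ^+ 2 = (r ^+ 2 + s ^+ 2) / r ^+ 2 by field.
  by rewrite sqrtrM ?(ltW n0)// sqrtrV ?sqr_ge0// sqrtr_sqr (gtr0_norm r0) invf_div.
have h1 := atan_gtNpi2 (s / r); have h2 := atan_ltpi2 (s / r); have p0 := @pi_gt0 R.
rewrite /carg nE /= cE; case: ifPn => s0.
  have a0 : 0 <= atan (s / r) by rewrite -[leLHS]atan0 le_atan// divr_ge0// ltW.
  by rewrite cosK// in_itv/= a0/=; lra.
have a0 : atan (s / r) <= 0.
  by rewrite -[leRHS]atan0 le_atan// nmulr_rle0 ?invr_ge0 ?ltNge// ltW.
by rewrite cosKN ?opprK// a0 andbT; lra.
Qed.

Lemma cpow_pos x p : 0 < x -> cpow x%:C p =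
  (expR (complex.Re p * ln x) * cos (complex.Im p * ln x)) +i*
  (expR (complex.Re p * ln x) * sin (complex.Im p * ln x)).
Proof.
case: p => [a b] x0; rewrite /cpow clog_pos// /cexp /=.
by rewrite !mulr0 subr0 add0r.
Qed.

Lemma cpow_half x : 0 < x -> cpow x%:C (- 2^-1) = ((Num.sqrt x)^-1)%:C.
Proof.
move=> x0; have -> : - 2^-1 = (- 2^-1)%:C :> R[i] by rewrite rmorphN fmorphV rmorph_nat.
rewrite cpow_pos//= mul0r cos0 sin0 mulr1 mulr0; congr (_ +i* _).
rewrite mulNr expRN -powR12_sqrt ?(ltW x0)// /powR gt_eqF//.
Qed.

(** Principal powers multiply here: x > 0 has argument 0, and 1 + a x and 1 / x + a lie in the right
    half-plane with the same argument. *)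
Lemma cpow_1Dmul (a p : R[i]) x : 0 <= complex.Re a -> 0 < x ->
  cpow (1 + a * x%:C) p = cpow x%:C p * cpow ((x^-1)%:C + a) p.
Proof.
case: a => [a b] /= a0 x0; rewrite /cpow -cexpD -mulrDr; congr (cexp (_ * _)).
have x1 := lt0r_neq0 x0.
have h : 0 < 1 + a * x by rewrite ltr_pwDl// mulr_ge0// ltW.
have h' : 0 < x^-1 + a by rewrite ltr_pwDl// invr_gt0.
have E : 1 + a * x = x * (x^-1 + a) by field.
rewrite clog_Re_gt0/=; last by rewrite mulr0 subr0.
rewrite (clog_Re_gt0 (_ + _))/= ?clog_pos// !mulr0 !subr0 !add0r.
apply/eqP; rewrite eq_complex /=; apply/andP; split; apply/eqP.
  have -> : (1 + a * x) ^+ 2 + (b * x) ^+ 2 = x ^+ 2 * ((x^-1 + a) ^+ 2 + b ^+ 2) by field.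
  rewrite lnM ?posrE ?exprn_gt0 ?ltr_pwDl ?sqr_ge0 ?exprn_gt0//.
  by rewrite lnXn//; field.
rewrite add0r; congr atan; rewrite E; move: (x^-1 + a) (lt0r_neq0 h') => v v0.
by field; rewrite ?x1 ?v0.
Qed.

End ComplexPowers.

(** * Assembly of the complex identities *)

Section ComplexIntegrals.
Context {R : realType}.
Notation mu := (@lebesgue_measure R).
Notation D := (`]0%R, +oo[%classic : set R).

Lemma in_pos (x : R) : x \in D -> 0 < x.
Proof. by rewrite inE/= in_itv/= andbT. Qed.

Lemma eq_cintegrable (f g : R -> R[i]) : (forall x, 0 < x -> f x = g x) ->
  cintegrable `]0, +oo[ f -> cintegrable `]0, +oo[ g.
Proof.
move=> fg [f1 f2]; split; [apply: eq_integrable f1|apply: eq_integrable f2] => // x;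
  by rewrite inE/= in_itv/= andbT => /fg ->.
Qed.

Lemma eq_cintegral (f g : R -> R[i]) : (forall x, 0 < x -> f x = g x) ->
  cintegral `]0, +oo[ f = cintegral `]0, +oo[ g.
Proof.
move=> fg; rewrite /cintegral; congr (_ +i* _); apply: eq_Rintegral => x;
  by rewrite inE/= in_itv/= andbT => /fg ->.
Qed.

Lemma cintegralZl (c : R[i]) (f : R -> R[i]) : cintegrable `]0, +oo[ f ->
  cintegrable `]0, +oo[ (fun x => c * f x) /\
  cintegral `]0, +oo[ (fun x => c * f x) = c * cintegral `]0, +oo[ f.
Proof.
case: c => [c1 c2] [f1 f2].
have [i1 e1] := integral_lin4 _ _ _ _ c1 (- c2) 0 0 f1 f2 f1 f2.
have [i2 e2] := integral_lin4 _ _ _ _ c2 c1 0 0 f1 f2 f1 f2.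
have reE x : complex.Re ((c1 +i* c2) * f x) = c1 * complex.Re (f x) + - c2 * complex.Im (f x) +
    (0 * complex.Re (f x) + 0 * complex.Im (f x)).
  by case: (f x) => a b /=; ring.
have imE x : complex.Im ((c1 +i* c2) * f x) = c2 * complex.Re (f x) + c1 * complex.Im (f x) +
    (0 * complex.Re (f x) + 0 * complex.Im (f x)).
  by case: (f x) => a b /=; ring.
split.
  by split; [apply: eq_integrable i1|apply: eq_integrable i2] => // x _; rewrite ?reE ?imE.
rewrite /cintegral.
rewrite (@eq_Rintegral _ _ R mu D _ _ (fun x _ => reE x)) e1.
rewrite (@eq_Rintegral _ _ R mu D _ _ (fun x _ => imE x)) e2.
by apply/eqP; rewrite eq_complex /=; apply/andP; split; apply/eqP; ring.
Qed.

Lemma cGammaE (p : R[i]) :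
  cGamma p = Gcos (complex.Re p) (complex.Im p) 1 0 +i* Gsin (complex.Re p) (complex.Im p) 1 0.
Proof.
rewrite /cGamma /cintegral; congr (_ +i* _); apply: eq_Rintegral => t /in_pos t0;
  rewrite cpow_pos//; case: p => [a b] /=;
  rewrite /gcos /gsin /gabs mul0r !subr0 mul1r expRD !mulr0 ?subr0 ?add0r; ring.
Qed.

Lemma cGamma_neq0 (p : R[i]) : 0 < complex.Re p -> cGamma p != 0.
Proof.
move=> p0; apply/negP => /eqP; rewrite cGammaE => -[h1 h2].
exact: (Gamma_neq0 _ _ p0 (conj h1 h2)).
Qed.

Section Transform.
Variables (p a : R[i]).
Hypotheses (p0 : 0 < complex.Re p) (a0 : 0 <= complex.Re a).

Let sg := complex.Re p.
Let tau := complex.Im p.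
Let a1 := complex.Re a.
Let a2 := complex.Im a.

(** Modulus, then real and imaginary parts, of x^(2p-1) exp(-a x^2 / pi) for x > 0. *)
Let habs (x : R) := expR ((2 * sg - 1) * ln x - a1 * (x ^+ 2 / pi)).
Let hre (x : R) := habs x * cos (2 * tau * ln x - a2 * (x ^+ 2 / pi)).
Let him (x : R) := habs x * sin (2 * tau * ln x - a2 * (x ^+ 2 / pi)).

Let h0 (x : R) := cpow x%:C (2 * p - 1) * cexp (- (a * (x ^+ 2)%:C / pi%:C)).

Let h0E x : 0 < x -> h0 x = hre x +i* him x.
Proof.
move=> x0.
have -> : h0 x = cexp ((2 * p - 1) * (ln x)%:C - a * (x ^+ 2 / pi)%:C).
  have E : (x ^+ 2 / pi)%:C = (x ^+ 2)%:C / pi%:C :> R[i] by rewrite rmorphM fmorphV.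
  by rewrite /h0 /cpow clog_pos// -cexpD E mulrA.
rewrite /cexp /hre /him /habs /sg /tau /a1 /a2; case: p a => [b c] [d e] /=.
congr ((expR _ * cos _) +i* (expR _ * sin _)); ring.
Qed.

Let pi0 : 0 < (pi : R). Proof. exact: pi_gt0. Qed.

(* substitution [u = x ^ 2 / pi] *)
Let transform (v : R) : 0 < v ->
  (\int[mu]_(x in `]0, +oo[) (hre x * expR (- (x ^+ 2 / pi * v)))) +i*
  (\int[mu]_(x in `]0, +oo[) (him x * expR (- (x ^+ 2 / pi * v)))) =
  cpow pi%:C p * cGamma p / 2 / cpow (v%:C + a) p.
Proof.
move=> v0.
have r0 : 0 < v + a1 by rewrite ltr_pwDl.
(* The modulus of pi^p / 2, the factor in x^(2p-1) dx = (pi^p / 2) u^(p-1) du; its argument tau ln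
   pi is split off in [angleE]. *)
pose C := expR (sg * ln pi) / 2.
have P0 := lt0r_neq0 pi0.
have sub (g : R -> R) : (forall x : R, 0 < x -> {for x, continuous g}) ->
    mu.-integrable `]0, +oo[ (EFin \o g) ->
    mu.-integrable `]0, +oo[ (EFin \o (fun x => g (x ^+ 2 / pi) * (2 * x / pi))) /\
    \int[mu]_(x in `]0, +oo[) (g (x ^+ 2 / pi) * (2 * x / pi)) = \int[mu]_(x in `]0, +oo[) g x.
  move=> cg ig; apply: (substitution_0y g (fun x => x ^+ 2 / pi) (fun x => 2 * x / pi)) => //.
  - by move=> x x0; rewrite divr_gt0 ?exprn_gt0.
  - by move=> x x0; rewrite divr_ge0 ?mulr_ge0 ?ltW.
  - by move=> x x0; apply: hasder_eq; [derive|rewrite /=; ring].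
  - by move=> x x0; apply: hasder_continuous; derive.
  - apply: (@cvg_to_eq _ _ _ _ (0 ^+ 2 / pi)); last by rewrite expr0n mul0r.
    have c : {for 0, continuous (fun x : R => x ^+ 2 / pi)} by apply: hasder_continuous; derive.
    by apply: cvg_at_right_filter; exact: c.
  - by apply: gt0_cvgMly; [rewrite invr_gt0|exact: cvgr_expr2].
have [ic Ec] := sub _ (gcos_continuous sg tau (v + a1) a2) (gcos_integrable _ tau _ a2 p0 r0).
have [is_ Es] := sub _ (gsin_continuous sg tau (v + a1) a2) (gsin_integrable _ tau _ a2 p0 r0).
have absE x : 0 < x -> habs x * expR (- (x ^+ 2 / pi * v)) =
    C * (gabs sg (v + a1) (x ^+ 2 / pi) * (2 * x / pi)).
  move=> x0.
  have -> : 2 * x / pi = 2 * expR (ln x - ln pi) by rewrite expRB (lnK x0) (lnK pi0) mulrA.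
  rewrite /C /gabs /habs ln_div ?posrE ?exprn_gt0// lnXn// -expRD.
  transitivity (expR (sg * ln pi) * (expR ((sg - 1) * (ln x *+ 2 - ln pi) - (v + a1) * (x ^+ 2 / pi)) * expR (ln x - ln pi))); last by field.
  by rewrite -!expRD; congr expR; ring.
have [_ e1] := integral_lin4 _ _ _ _ (C * cos (tau * ln pi)) (- (C * sin (tau * ln pi))) 0 0 ic is_ ic is_.
have [_ e2] := integral_lin4 _ _ _ _ (C * sin (tau * ln pi)) (C * cos (tau * ln pi)) 0 0 ic is_ ic is_.
rewrite !mul0r !addr0 Ec Es -!/(Gcos _ _ _ _) -!/(Gsin _ _ _ _) in e1 e2.
have angleE x : 0 < x -> 2 * tau * ln x - a2 * (x ^+ 2 / pi) =
    tau * ln pi + (tau * ln (x ^+ 2 / pi) - a2 * (x ^+ 2 / pi)).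
  by move=> x0; rewrite ln_div ?posrE ?exprn_gt0// lnXn//; ring.
have -> : \int[mu]_(x in `]0, +oo[) (hre x * expR (- (x ^+ 2 / pi * v))) =
    C * cos (tau * ln pi) * Gcos sg tau (v + a1) a2 + - (C * sin (tau * ln pi)) * Gsin sg tau (v + a1) a2.
  rewrite -e1; apply: eq_Rintegral => x /in_pos x0.
  rewrite /hre mulrAC absE// angleE// cosD /gcos /gsin; ring.
have -> : \int[mu]_(x in `]0, +oo[) (him x * expR (- (x ^+ 2 / pi * v))) =
    C * sin (tau * ln pi) * Gcos sg tau (v + a1) a2 + C * cos (tau * ln pi) * Gsin sg tau (v + a1) a2.
  rewrite -e2; apply: eq_Rintegral => x /in_pos x0.
  rewrite /him mulrAC absE// angleE// sinD /gcos /gsin; ring.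
have wE : complex.Re (v%:C + a) = v + a1 /\ complex.Im (v%:C + a) = a2.
  by rewrite /a1 /a2; case: a => b c /=; rewrite add0r.
pose G := Gcos sg tau (v + a1) a2 +i* Gsin sg tau (v + a1) a2.
have GE : cGamma p = cpow (v%:C + a) p * G.
  have [g1 g2] := Gamma_rotation sg tau p0 (v + a1) a2 r0.
  rewrite cGammaE -/sg -/tau g1 g2 /cpow clog_Re_gt0 wE.1 ?wE.2//.
  rewrite /cexp /G /sg /tau; case: p => b c /=.
  by apply/eqP; rewrite eq_complex /=; apply/andP; split; apply/eqP; ring.
have -> : cpow pi%:C p * cGamma p / 2 / cpow (v%:C + a) p = cpow pi%:C p / 2 * G.
  rewrite GE; have := cpow_neq0 (v%:C + a) p; move: (cpow _ p) (cpow _ p) => P W W0.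
  by field; rewrite ?W0.
have -> : cpow pi%:C p / 2 = (C * cos (tau * ln pi)) +i* (C * sin (tau * ln pi)).
  have -> : 2^-1 = (2^-1)%:C :> R[i] by rewrite fmorphV rmorph_nat.
  rewrite cpow_pos// -/sg -/tau /C.
  by apply/eqP; rewrite eq_complex /=; apply/andP; split; apply/eqP; ring.
by apply/eqP; rewrite eq_complex /=; apply/andP; split; apply/eqP; ring.
Qed.

Section Weight.
Variables (phi w0 : R -> R).
Hypotheses
  (mphi : measurable_fun D phi)
  (mw0 : measurable_fun D w0)
  (phi0 : forall y : R, 0 < y -> 0 <= phi y)
  (w00 : forall y : R, 0 < y -> 0 < w0 y)
  (phiE : forall x : R, 0 < x ->
    (\int[mu]_(y in `]0%R, +oo[) (phi y * expR (- (x ^+ 2 / pi * w0 y)))%:E = ((cosh x)^-1)%:E)%E).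

Let f (y : R) := (phi y)%:C / cpow ((w0 y)%:C + a) p.
Let h (x : R) := h0 x / (cosh x)%:C.

(** Fubini delivers the integrability and the integral of c f with c = pi^p Gamma(p) / 2; dividing
    by [c] is where [cGamma_neq0] enters. *)
Lemma sech_transform : [/\ cintegrable `]0, +oo[ f, cintegrable `]0, +oo[ h &
  cintegral `]0, +oo[ f = 2 / (cpow pi%:C p * cGamma p) * cintegral `]0, +oo[ h].
Proof.
have b0 : 0 < 2 * sg by rewrite mulr_gt0.
have c1 (u : R) : 0 < u -> {for u, continuous hre}.
  by move=> u0; apply: hasder_continuous; rewrite /hre /habs; derive.
have c2 (u : R) : 0 < u -> {for u, continuous him}.
  by move=> u0; apply: hasder_continuous; rewrite /him /habs; derive.
have hle u : 0 < u -> habs u <= expR ((2 * sg - 1) * ln u).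
  move=> u0; rewrite ler_expR gerBl mulr_ge0// divr_ge0 ?sqr_ge0//; exact: ltW.
have l1 (u : R) : 0 < u -> `|hre u| <= expR ((2 * sg - 1) * ln u).
  move=> u0; apply: le_trans (hle u u0); rewrite normrM (gtr0_norm (expR_gt0 _)).
  by rewrite ler_piMr ?expR_ge0// cos_max.
have l2 (u : R) : 0 < u -> `|him u| <= expR ((2 * sg - 1) * ln u).
  move=> u0; apply: le_trans (hle u u0); rewrite normrM (gtr0_norm (expR_gt0 _)).
  by rewrite ler_piMr ?expR_ge0// sin_max.
have k1 := integrable_kernel_cosh _ _ b0 c1 l1.
have k2 := integrable_kernel_cosh _ _ b0 c2 l2.
have [i1 e1] := fubini_kernel phi w0 hre _ b0 mphi mw0 phi0 w00 phiE c1 l1.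
have [i2 e2] := fubini_kernel phi w0 him _ b0 mphi mw0 phi0 w00 phiE c2 l2.
pose c := cpow pi%:C p * cGamma p / 2.
have c0 : c != 0.
  by rewrite mulf_neq0 ?invr_eq0 ?pnatr_eq0// mulf_neq0 ?cpow_neq0 ?cGamma_neq0.
have hE x : 0 < x -> h x = (hre x / cosh x) +i* (him x / cosh x).
  move=> x0; rewrite /h h0E// -fmorphV.
  by apply/eqP; rewrite eq_complex /=; apply/andP; split; apply/eqP; ring.
pose Jre y := \int[mu]_(x in `]0, +oo[) (hre x * expR (- (x ^+ 2 / pi * w0 y))).
pose Jim y := \int[mu]_(x in `]0, +oo[) (him x * expR (- (x ^+ 2 / pi * w0 y))).
have cfE y : 0 < y -> (phi y * Jre y) +i* (phi y * Jim y) = c * f y.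
  move=> y0; have := transform _ (w00 y y0); rewrite -/(Jre y) -/(Jim y) -/c => T.
  transitivity ((phi y)%:C * (Jre y +i* Jim y)).
    by apply/eqP; rewrite eq_complex /=; apply/andP; split; apply/eqP; ring.
  by rewrite T /f mulrCA mulrA.
pose F y := (phi y * Jre y) +i* (phi y * Jim y).
have iF : cintegrable `]0, +oo[ F by split.
have ih : cintegrable `]0, +oo[ h.
  apply: (@eq_cintegrable (fun x => (hre x / cosh x) +i* (him x / cosh x))); last by split.
  by move=> x x0; rewrite hE.
have [j1 j2] := cintegralZl c^-1 _ iF.
have fE y : 0 < y -> c^-1 * F y = f y by move=> y0; rewrite /F cfE// mulKf.
split => //; first exact: eq_cintegrable j1.
rewrite -(eq_cintegral _ _ fE) j2; congr (_ * _).
  by rewrite /c invf_div.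
rewrite (eq_cintegral _ _ hE) /cintegral /F /=; congr (_ +i* _); [exact: e1|exact: e2].
Qed.

End Weight.
End Transform.
End ComplexIntegrals.

Theorem proposition5 (R : realType) (p a : R[i])
    (hp : 0 < complex.Re p) (ha : 0 <= complex.Re a) :
  let f := fun x : R => (eta_im x ^+ 3)%:C / cpow (x%:C + a) p in
  let g := fun y : R =>
    cpow y%:C (p - 2^-1) * (eta_im y ^+ 3)%:C / cpow (1 + a * y%:C) p in
  let h := fun x : R =>
    cpow x%:C (2 * p - 1) * cexp (- (a * (x ^+ 2)%:C / pi%:C)) / (cosh x)%:C in
  [/\ cintegrable `]0, +oo[ f,
      cintegrable `]0, +oo[ g,
      cintegrable `]0, +oo[ h,
      cintegral `]0, +oo[ f = cintegral `]0, +oo[ g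
    & cintegral `]0, +oo[ g =
        2 / (cpow pi%:C p * cGamma p) * cintegral `]0, +oo[ h].
Proof.
move=> f g h.
have [f1 h1 e1] := sech_transform p a hp ha (fun y : R => eta_im y ^+ 3) id
  measurable_eta3 (@measurable_id _ _ _) (@eta3_ge0 R) (fun y y0 => y0) (@integral_eta3_expN R).
pose phi (y : R) := eta_im y ^+ 3 * (Num.sqrt y)^-1.
have mD : forall (u : R -> R), (forall y : R, 0 < y -> {for y, continuous u}) ->
    measurable_fun (`]0, +oo[ : set R) u by exact: continuous_measurable_pos.
have mphi : measurable_fun (`]0, +oo[ : set R) phi.
  apply: measurable_funM; first exact: measurable_eta3.
  apply: mD => y y0; have s0 : Num.sqrt y != 0 by rewrite lt0r_neq0// sqrtr_gt0.
  by apply: hasder_continuous; derive.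
have minv : measurable_fun (`]0, +oo[ : set R) (fun y : R => y^-1).
  by apply: mD => y y0; have y1 := lt0r_neq0 y0; apply: hasder_continuous; derive.
have phi0 (y : R) : 0 < y -> 0 <= phi y.
  by move=> y0; rewrite mulr_ge0 ?invr_ge0 ?sqrtr_ge0 ?eta3_ge0.
have inv0 (y : R) : 0 < y -> 0 < y^-1 by rewrite invr_gt0.
have phiE (x : R) : 0 < x -> (\int[@lebesgue_measure R]_(y in `]0%R, +oo[)
    (phi y * expR (- (x ^+ 2 / pi * y^-1)))%:E = ((cosh x)^-1)%:E)%E.
  by move=> x0; rewrite -integral_eta3_expN_inv//; apply: eq_integral => y _; rewrite /phi mulrA.
have [g1 _ e2] := sech_transform p a hp ha phi (fun y => y^-1) mphi minv phi0 inv0 phiE.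
(* (1 + a y)^p = y^p (1 / y + a)^p, so y^(p-1/2) in [g] leaves just the y^(-1/2) of [phi]. *)
have gE y : 0 < y -> (phi y)%:C / cpow ((y^-1)%:C + a) p = g y.
  move=> y0; rewrite /g cpow_1Dmul// cpowDr cpow_half// /phi rmorphM/= invfM.
  set A := cpow y%:C p; have A0 : A != 0 by exact: cpow_neq0.
  set B := cpow _ p; have B0 : B != 0 by exact: cpow_neq0.
  by move: ((Num.sqrt y)^-1)%:C => S; field; rewrite ?A0 ?B0.
have G1 := eq_cintegrable _ _ gE g1; rewrite (eq_cintegral _ _ gE) in e2.
split; [exact: f1|exact: G1|exact: h1| |exact: e2].
exact: etrans e1 (esym e2).
Qed.
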